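(* Let $\mathbb{F}$ be a field and let $M\in\mathrm{GL}_n(\mathbb{F})$ be such that $\det M=\pm 1$. Assume that $M$ has at most one Jordan cell of size $1$ for each one of its eigenvalues in $\mathbb{F}$, and that the characteristic polynomial of $M$ is not a power of some irreducible polynomial of $\mathbb{F}[t]$. Then, for all $k\in\{0,1,2\}$, the matrix $M$ is the product of $k$ unipotent matrices of index $2$ and $3-k$ involutions. Moreover, if $\det M=1$ then $M$ is the product of three $U_2$-matrices.
   Context: A matrix $A\in\mathrm{GL}_n(\mathbb{F})$ is an involution if $A^2=I_n$, and it is unipotent of index $2$ (a $U_2$-matrix) if $(A-I_n)^2=0$; $I_n$ is both. A product of $k$ unipotent matrices of index $2$ and $3-k$ involutions means a product of three factors of these types in some order (a matrix that is such a product in one prescribed order is also such a product in any other order). *)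

(* Defs.v *)
From mathcomp Require Import all_boot all_order all_algebra.

Set Implicit Arguments.
Unset Strict Implicit.
Unset Printing Implicit Defensive.

Import GRing.Theory.
Local Open Scope ring_scope.

Definition involution (F : fieldType) (n : nat) (A : 'M[F]_n) : Prop :=
  A *m A = 1%:M.

Definition unipotent2 (F : fieldType) (n : nat) (A : 'M[F]_n) : Prop :=
  (A - 1%:M) *m (A - 1%:M) = 0.

Definition jordan_cell (F : fieldType) (a : F) (k : nat) : 'M[F]_k :=
  \matrix_(i, j) (if i == j then a else if j == i.+1 :> nat then 1 else 0).

(* [p 0, ..., p (m - 1)] are the sizes of the Jordan cells of M for a: M is
   similar to the direct sum of these cells and of a matrix N without
   eigenvalue a. The base change P has sizes that are equal only propositionally
   (row_free together with row_full forces \sum_i p i + r = n). *)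
Definition jordan_sizes (F : fieldType) (n : nat) (M : 'M[F]_n) (a : F)
    (m : nat) (p : 'I_m -> nat) : Prop :=
  (forall i, 0 < p i)%N /\
  exists (r : nat) (N : 'M[F]_r) (P : 'M[F]_(\sum_i p i + r, n)),
    [/\ ~~ eigenvalue N a, row_free P, row_full P &
        P *m M = block_mx (\mxdiag_(i < m) jordan_cell a (p i)) 0 0 N *m P].

(* The multiset of cell sizes is unique, hence the quantification over all
   Jordan decompositions. *)
Definition at_most_one_jordan_cell_of_size1
    (F : fieldType) (n : nat) (M : 'M[F]_n) (a : F) : Prop :=
  forall (m : nat) (p : 'I_m -> nat),
    jordan_sizes M a p -> (#|[set i | p i == 1%N]| <= 1)%N.

(* The Booleans say which type each factor is taken to have; this matters
   because some matrices, such as the identity, have both. *)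
Definition prod_unipotent2_involution
    (F : fieldType) (n : nat) (k : nat) (M : 'M[F]_n) : Prop :=
  exists (u : 'I_3 -> bool) (A : 'I_3 -> 'M[F]_n),
    [/\ #|[set i | u i]| = k,
        forall i, if u i then unipotent2 (A i) else involution (A i) &
        M = A 0 *m A 1 *m A 2%:R].

(* Main.v *)
Require Import Defs.
From mathcomp Require Import all_boot all_order all_algebra.
From mathcomp Require Import ring zify.
From Stdlib Require Import Classical_Prop.

Set Implicit Arguments.
Unset Strict Implicit.
Unset Printing Implicit Defensive.

Import GRing.Theory.
Local Open Scope ring_scope.

(** Let delta be 1 or -1 and call A quadratic for delta when
    (A - 1)(A - delta) = 0: these are the unipotent matrices of index 2 when
    delta = 1 and the involutions when delta = -1, so both kinds of factors
    are treated at once.  Matrices act on row vectors.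

    Idea.  If W is a space of row vectors and K is a matrix that agrees with M
    on W and with delta M modulo W M, then K M^-1 fixes W pointwise and acts as
    delta modulo W; hence it is quadratic for delta, and so is its inverse T,
    with M = T K ([completion_factor]).  The matrix K can thus be changed freely
    on a complement of W by vectors of W M.  It suffices to choose W and K so
    that K is cyclic with the same characteristic polynomial as a cyclic product
    B C of two quadratic matrices: K is then conjugate to B C, and M is a
    product of three quadratic matrices ([three_quadratics]).  Explicit products
    B C, in which two mirror symmetries of the basis compose to a shift, are
    given by [two_quadratics]; the only constraint on them is the determinant.

    The problem is therefore to show that K can be made cyclic with an arbitrary
    characteristic polynomial R, up to the value R(0) imposed by the
    determinant ([completable]).  When M is cyclic this is immediate: change the
    last row of a companion matrix.  Otherwise M is a direct sum of cyclic
    blocks, of which the first one, the pivot, has size at least 3.  The blocks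
    are attached one after the other ([flexible_block]).  Attaching a block with
    polynomial p to a part with polynomial P uses one vector by which the old
    part feeds the new block, and several vectors of W M by which the new
    block feeds back; the polynomial becomes P p - X S, where S depends linearly
    on the feedback ([ext_annihilated]).  For a given R one looks for feedback
    vectors such that R + X S is divisible by p; the quotient is the polynomial P
    to prescribe on the old part.  A pivot of size at least 3 provides two
    feedback vectors, and by [window_mod] these are enough for every block of
    size at least 2.  A pair of blocks of size 2 with different determinants
    can replace the pivot ([flexible_two_quadratics]).

    It remains to find such a decomposition.  A vector v with a Krylov sequence
    of maximal length d spans an invariant space, and a functional phi that
    takes the values 0, ..., 0, 1 on that sequence has, by symmetry between M
    and its transpose, a Krylov sequence of length d as well; the common kernel
    of the latter is an invariant complement ([cyclic_split]).  Iterating gives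
    cyclic blocks C, N_1, N_2, ... such that the characteristic polynomial p of
    C kills M.  If a block has size 1, so have all later ones, with the same
    eigenvalue a; two of them would be two Jordan cells of size 1
    ([no_two_cells]), so there is at most one.  If there is one, then
    p = (X - a)^k q with q(a) <> 0, where k > 1 for the same reason and q <> 1
    because the characteristic polynomial of M is not a power of X - a; the
    blocks p and X - a can then be rearranged into (X - a)^k and (X - a) q,
    both of degree at least 2 ([flexible_split_cell]).  If no block can serve as
    a pivot, then k = 2, q = X - b, and the pair (X - a) q, (X - a)^2 of
    determinants a b and a^2 is used.  Finally, the pivot has size at least 3
    unless M is cyclic: if p has degree 1, or is irreducible of degree 2, or is
    a square (X - a)^2, then the characteristic polynomial of M is a power of
    an irreducible polynomial, and if p = (X - a)(X - b) with a <> b, then a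
    second block would give two cells of size 1 for a or for b. *)

(** * Similarity of matrices *)

Section Similar.
Variable F : fieldType.

(** The sizes m and n are equal as soon as such P and Q exist, but direct sums
    produce them as syntactically different numbers. *)
Definition similar_mx m n (A : 'M[F]_m) (B : 'M[F]_n) : Prop :=
  exists (P : 'M[F]_(n, m)) (Q : 'M[F]_(m, n)),
    [/\ P *m Q = 1%:M, Q *m P = 1%:M & P *m A = B *m P].

Lemma similar_refl n (A : 'M[F]_n) : similar_mx A A.
Proof. by exists 1%:M, 1%:M; rewrite !mulmx1 mul1mx. Qed.

Lemma similar_sym m n (A : 'M[F]_m) (B : 'M[F]_n) :
  similar_mx A B -> similar_mx B A.
Proof.
case=> P [Q [PQ QP PA]]; exists Q, P; split=> //.
by rewrite -[A]mul1mx -QP -!(mulmxA Q) PA -!mulmxA PQ mulmx1.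
Qed.

Lemma similar_trans m n p (A : 'M[F]_m) (B : 'M[F]_n) (C : 'M[F]_p) :
  similar_mx A B -> similar_mx B C -> similar_mx A C.
Proof.
case=> P [Q [PQ QP PA]] [P' [Q' [PQ' QP' PB]]]; exists (P' *m P), (Q *m Q').
by rewrite -!mulmxA (mulmxA P) PQ mul1mx PQ' (mulmxA Q') QP' mul1mx QP PA
  (mulmxA P') PB -mulmxA.
Qed.

Lemma similar_unit n (A B P : 'M[F]_n) :
  P \in unitmx -> P *m A = B *m P -> similar_mx A B.
Proof. by move=> Pu PA; exists P, (invmx P); rewrite mulmxV ?mulVmx. Qed.

Lemma similar_size m n (A : 'M[F]_m) (B : 'M[F]_n) : similar_mx A B -> m = n.
Proof.
case=> P [Q [PQ QP _]]; apply/eqP; rewrite eqn_leq.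
have := mxrankM_maxr Q P; have := mxrankM_maxr P Q.
rewrite PQ QP !mxrank1 => le1 le2.
by rewrite (leq_trans le2 (rank_leq_row _)) (leq_trans le1 (rank_leq_row _)).
Qed.

Lemma similarP n (A B : 'M[F]_n) : similar_mx A B ->
  exists2 P, P \in unitmx & P *m A = B *m P.
Proof. by case=> P [Q [PQ _ PA]]; exists P; case/mulmx1_unit: PQ. Qed.

Lemma similar_char_poly m n (A : 'M[F]_m) (B : 'M[F]_n) :
  similar_mx A B -> char_poly A = char_poly B.
Proof.
move=> AB; have mn := similar_size AB; subst m; case: (similarP AB) => P Pu PA.
have : map_mx polyC P *m char_poly_mx A = char_poly_mx B *m map_mx polyC P.
  rewrite /char_poly_mx mulmxBr mulmxBl -!map_mxM PA mul_mx_scalar.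
  by rewrite mul_scalar_mx.
move/(congr1 determinant); rewrite !det_mulmx mulrC; apply: mulIf.
by rewrite det_map_mx polyC_eq0 -unitfE -unitmxE.
Qed.

Lemma similar_det m n (A : 'M[F]_m) (B : 'M[F]_n) :
  similar_mx A B -> \det A = \det B.
Proof.
move=> AB; have mn := similar_size AB; subst m; case: (similarP AB) => P Pu PA.
have := congr1 determinant PA; rewrite !det_mulmx mulrC; apply: mulIf.
by rewrite unitmxE unitfE in Pu.
Qed.

Lemma similar_block m n m' n' (A : 'M[F]_m) (B : 'M[F]_n)
    (A' : 'M[F]_m') (B' : 'M[F]_n') :
  similar_mx A A' -> similar_mx B B' ->
  similar_mx (block_mx A 0 0 B) (block_mx A' 0 0 B').
Proof.
case=> P [Q [PQ QP PA]] [P' [Q' [PQ' QP' PB]]].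
exists (block_mx P 0 0 P'), (block_mx Q 0 0 Q').
by rewrite !mulmx_block !(mulmx0, mul0mx, addr0, add0r) PQ QP PQ' QP' PA PB
  -!scalar_mx_block.
Qed.

Lemma similar_blockC m n (A : 'M[F]_m) (B : 'M[F]_n) :
  similar_mx (block_mx A 0 0 B) (block_mx B 0 0 A).
Proof.
exists (block_mx 0 1%:M 1%:M 0), (block_mx 0 1%:M 1%:M 0).
by rewrite !mulmx_block !(mulmx0, mul0mx, addr0, add0r, mul1mx, mulmx1)
  -!scalar_mx_block.
Qed.

Lemma similar_cast m n (e : m = n) (A : 'M[F]_m) :
  similar_mx A (castmx (e, e) A).
Proof. by case: n / e; rewrite castmx_id; apply: similar_refl. Qed.

Lemma similar_blockA m n p (A : 'M[F]_m) (B : 'M[F]_n) (C : 'M[F]_p) :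
  similar_mx (block_mx A 0 0 (block_mx B 0 0 C))
             (block_mx (block_mx A 0 0 B) 0 0 C).
Proof.
apply: similar_trans (similar_cast (addnA m n p) _) _.
rewrite -[0 : 'M_(m, n + p)]row_mx0 -[0 : 'M_(n + p, m)]col_mx0.
rewrite -[0 : 'M_(m + n, p)]col_mx0 -[0 : 'M_(p, m + n)]row_mx0.
rewrite block_mxA castmx_comp.
by rewrite castmx_id; apply: similar_refl.
Qed.

Lemma similar_block0 m (A : 'M[F]_m) (B : 'M[F]_0) :
  similar_mx (block_mx A 0 0 B) A.
Proof.
exists (row_mx 1%:M 0), (col_mx 1%:M 0).
rewrite mul_row_col mul_col_row mul_row_block !(mulmx0, mul0mx, addr0, mul1mx).
split=> //.
  rewrite scalar_mx_block; congr block_mx; rewrite ?flatmx0 ?thinmx0 //;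
    by apply/matrixP; case.
by rewrite mul_mx_row mulmx1 mulmx0.
Qed.
End Similar.

(** * Polynomials acting on row vectors, cyclic and companion matrices *)

Section PolynomialAction.
Variable F : fieldType.

(** The value at M of the polynomial h, applied to v; [horner_mx] would require
    the size of M to be a successor. *)
Definition pact n (v : 'rV[F]_n) (M : 'M[F]_n) (h : {poly F}) : 'rV[F]_n :=
  \sum_(i < size h) h`_i *: (v *m M ^+ i).

Section Theory.
Variables (n : nat) (M : 'M[F]_n).
Implicit Types (v w : 'rV[F]_n) (p q h : {poly F}).

Lemma pact_wide k v h : (size h <= k)%N ->
  pact v M h = \sum_(i < k) h`_i *: (v *m M ^+ i).
Proof.
move=> le_h_k; rewrite /pact (big_ord_widen _ (fun i => h`_i *: (v *m M ^+ i)) le_h_k).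
rewrite big_mkcond; apply: eq_bigr => i _; case: ltnP => // le_h_i.
by rewrite nth_default // scale0r.
Qed.

Lemma pactD v p q : pact v M (p + q) = pact v M p + pact v M q.
Proof.
pose k := maxn (size p) (size q).
rewrite !(@pact_wide k) ?leq_maxl ?leq_maxr ?size_polyD //.
by rewrite -big_split; apply: eq_bigr => i _; rewrite coefD scalerDl.
Qed.

Lemma pactZ v c p : pact v M (c *: p) = c *: pact v M p.
Proof.
rewrite !(@pact_wide (size p)) ?size_scale_leq // scaler_sumr.
by apply: eq_bigr => i _; rewrite coefZ scalerA.
Qed.

Lemma pactN v p : pact v M (- p) = - pact v M p.
Proof. by rewrite -scaleN1r pactZ scaleN1r. Qed.

Lemma pactB v p q : pact v M (p - q) = pact v M p - pact v M q.
Proof. by rewrite pactD pactN. Qed.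

Lemma pact0 v : pact v M 0 = 0.
Proof. by rewrite /pact size_poly0 big_ord0. Qed.

Lemma pact0l p : pact 0 M p = 0.
Proof. by rewrite /pact big1 // => i _; rewrite mul0mx scaler0. Qed.

Lemma pactDl v w p : pact (v + w) M p = pact v M p + pact w M p.
Proof. by rewrite -big_split; apply: eq_bigr => i _; rewrite mulmxDl scalerDr. Qed.

Lemma pactZl v c p : pact (c *: v) M p = c *: pact v M p.
Proof.
by rewrite scaler_sumr; apply: eq_bigr => i _; rewrite -scalemxAl !scalerA mulrC.
Qed.

Lemma pactC v c : pact v M c%:P = c *: v.
Proof.
by rewrite (@pact_wide 1) ?size_polyC ?leq_b1 // big_ord1 coefC mulmx1.
Qed.

Lemma pact_Xn v i : pact v M 'X^i = v *m M ^+ i.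
Proof.
rewrite (@pact_wide i.+1) ?size_polyXn // big_ord_recr big1 /= => [|j _].
  by rewrite add0r coefXn eqxx scale1r.
by rewrite coefXn ltn_eqF // scale0r.
Qed.

Lemma pact_X v : pact v M 'X = v *m M.
Proof. by have := pact_Xn v 1; rewrite expr1. Qed.

Lemma pact_MX v p : pact v M (p * 'X) = pact v M p *m M.
Proof.
rewrite (@pact_wide (size p).+1); last first.
  by rewrite (leq_trans (size_polyMleq _ _)) ?size_polyX ?addn2.
rewrite big_ord_recl coefMX eqxx scale0r add0r mulmx_suml.
by apply: eq_bigr => i _; rewrite coefMX /= -scalemxAl -mulmxA exprSr.
Qed.

Lemma pactM v p q : pact v M (p * q) = pact (pact v M p) M q.
Proof.
elim/poly_ind: q => [|q c IHq]; first by rewrite mulr0 !pact0.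
rewrite mulrDr mulrA !pactD !pact_MX IHq pactC; congr (_ + _).
by rewrite mulrC mul_polyC pactZ.
Qed.

Lemma pact_mull v p : pact (v *m M) M p = pact v M p *m M.
Proof. by rewrite -pact_X -pactM mulrC pactM pact_X. Qed.

Lemma pact_char_poly v : pact v M (char_poly M) = 0.
Proof.
case: n M v => [|k] A v; first exact: thinmx0.
have -> : pact v A (char_poly A) = v *m horner_mx A (char_poly A).
  rewrite -{2}[char_poly A]coefK poly_def rmorph_sum mulmx_sumr.
  apply: eq_bigr => i _; rewrite /= linearZ /= rmorphXn /= horner_mx_X.
  by rewrite -scalemxAr.
by rewrite Cayley_Hamilton mulmx0.
Qed.

Lemma pact_dvd v p q : pact v M p = 0 -> p %| q -> pact v M q = 0.
Proof. by move=> pv0 /divpK <-; rewrite mulrC pactM pv0 pact0l. Qed.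
End Theory.

Lemma pact_morph m n (A : 'M[F]_m) (B : 'M[F]_n) (P : 'M[F]_(m, n)) v h :
  A *m P = P *m B -> pact v A h *m P = pact (v *m P) B h.
Proof.
move=> AP; rewrite mulmx_suml; apply: eq_bigr => i _.
rewrite -scalemxAl -!mulmxA; congr (_ *: (v *m _)).
elim: {i}(i : nat) => [|i IHi]; first by rewrite mul1mx mulmx1.
by rewrite !exprSr -[A ^+ i * A]/(A ^+ i *m A) -mulmxA AP mulmxA IHi mulmxA.
Qed.

Lemma pact_block m n (A : 'M[F]_m) (B : 'M[F]_n) u v h :
  pact (row_mx u v) (block_mx A 0 0 B) h = row_mx (pact u A h) (pact v B h).
Proof.
have e1 : block_mx A 0 0 B *m col_mx 1%:M 0 = col_mx 1%:M 0 *m A.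
  by rewrite mul_block_col mul_col_mx !(mulmx0, mul0mx, addr0, mulmx1, mul1mx).
have e2 : block_mx A 0 0 B *m col_mx 0 1%:M = col_mx 0 1%:M *m B.
  by rewrite mul_block_col mul_col_mx !(mulmx0, mul0mx, add0r, mulmx1, mul1mx).
rewrite -[LHS]mulmx1 (scalar_mx_block m n 1).
rewrite [X in _ *m X]block_mxEh mul_mx_row.
by rewrite (pact_morph _ _ e1) (pact_morph _ _ e2) !mul_row_col
  !(mulmx0, mulmx1, addr0, add0r).
Qed.
End PolynomialAction.

Section Cyclic.
Variable F : fieldType.

Definition krylov d n (v : 'rV[F]_n) (M : 'M[F]_n) : 'M[F]_(d, n) :=
  \matrix_(i < d) (v *m M ^+ i).

Definition cyclic_mx n (M : 'M[F]_n) : Prop :=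
  exists v, krylov n v M \in unitmx.

Lemma pact_krylov d n (v : 'rV[F]_n) (M : 'M[F]_n) (h : {poly F}) :
  (size h <= d)%N -> pact v M h = poly_rV h *m krylov d v M.
Proof.
move=> le_h; rewrite (pact_wide _ _ le_h) mulmx_sum_row.
by apply: eq_bigr => i _; rewrite rowK mxE.
Qed.

Lemma krylov_freeP d n (v : 'rV[F]_n) (M : 'M[F]_n) :
  reflect (forall h : {poly F}, (size h <= d)%N -> pact v M h = 0 -> h = 0)
          (row_free (krylov d v M)).
Proof.
apply: (iffP idP) => [fK h le_h | inj].
  rewrite (pact_krylov _ _ le_h) -(mul0mx _ (krylov d v M)).
  by move/(row_free_inj fK) => e; rewrite -(poly_rV_K le_h) e linear0.
rewrite -kermx_eq0; apply/rowV0P => u /sub_kermxP uK0.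
have := inj (rVpoly u) (size_poly _ _).
rewrite (@pact_krylov d) ?size_poly // rVpolyK => /(_ uK0) u0.
by rewrite -[u]rVpolyK u0 linear0.
Qed.

Lemma krylov_unitP n (v : 'rV[F]_n) (M : 'M[F]_n) :
  reflect (forall h : {poly F}, (size h <= n)%N -> pact v M h = 0 -> h = 0)
          (krylov n v M \in unitmx).
Proof. by rewrite -row_free_unit; apply: krylov_freeP. Qed.

Lemma pact_cyclic_dvd n (v : 'rV[F]_n) (M : 'M[F]_n) p h :
  krylov n v M \in unitmx -> p \is monic -> size p = n.+1 -> pact v M p = 0 ->
  pact v M h = 0 -> p %| h.
Proof.
move=> /krylov_unitP inj mon_p sz_p p0 h0; have nz_p := monic_neq0 mon_p.
apply/eqP/inj; first by rewrite -ltnS -sz_p ltn_modp.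
by move: h0; rewrite {1}(divp_eq h p) mulrC pactD pactM p0 pact0l add0r.
Qed.

Lemma cyclic_char_poly n (v : 'rV[F]_n) (M : 'M[F]_n) p :
  krylov n v M \in unitmx -> p \is monic -> size p = n.+1 -> pact v M p = 0 ->
  char_poly M = p.
Proof.
move=> uK mon_p sz_p p0.
have dv := pact_cyclic_dvd uK mon_p sz_p p0 (pact_char_poly M v).
apply/eqP; rewrite eq_sym -eqp_monic ?char_poly_monic //.
by rewrite -dvdp_size_eqp ?dv ?sz_p ?size_char_poly.
Qed.

(** Only the top coefficient of h survives phi, because phi vanishes on all but
    the last vector of the Krylov sequence. *)
Lemma pact_moment d n (v : 'rV[F]_n) (M : 'M[F]_n) (phi : 'cV[F]_n) c
    (h : {poly F}) :
  (forall i, (i < d)%N -> (v *m M ^+ i *m phi) 0 0 = c *+ (i.+1 == d)) ->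
  (size h <= d)%N -> (pact v M h *m phi) 0 0 = h`_d.-1 * c.
Proof.
move=> mom le_h; rewrite (pact_wide _ _ le_h) mulmx_suml summxE.
case: d => [|k] in mom le_h *.
  by rewrite big_ord0 nth_default ?mul0r.
rewrite big_ord_recr big1 /= => [|i _]; rewrite -scalemxAl mxE mom //=.
  by rewrite eqxx add0r mulr1n.
by rewrite eqSS ltn_eqF // mulr0.
by rewrite ltnS ltnW.
Qed.

(** Multiplying h by a power of X brings its leading coefficient to the position
    that phi detects.  This triangularity is the source of all independence
    statements about Krylov sequences below. *)
Lemma pact_moment_shift d n (v : 'rV[F]_n) (M : 'M[F]_n) (phi : 'cV[F]_n) c
    (h : {poly F}) :
  c != 0 -> h != 0 ->
  (forall i, (i < d)%N -> (v *m M ^+ i *m phi) 0 0 = c *+ (i.+1 == d)) ->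
  (size h <= d)%N -> (pact v M (h * 'X^(d - size h)) *m phi) 0 0 != 0.
Proof.
move=> nz_c nz_h mom le_h.
have szh : (0 < size h)%N by rewrite size_poly_gt0.
rewrite (pact_moment mom) ?size_mulXn ?subnK // mulf_neq0 // coefMXn.
have -> : (d.-1 < d - size h)%N = false by lia.
have -> : (d.-1 - (d - size h) = (size h).-1)%N by lia.
by rewrite -lead_coefE lead_coef_eq0.
Qed.

Lemma krylov_moment d n (v : 'rV[F]_n) (M : 'M[F]_n) (phi : 'cV[F]_n) c :
  c != 0 ->
  (forall i, (i < d)%N -> (v *m M ^+ i *m phi) 0 0 = c *+ (i.+1 == d)) ->
  row_free (krylov d v M).
Proof.
move=> nz_c mom; apply/krylov_freeP => h le_h h0; apply/eqP; apply: contraT => nz_h.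
have := pact_moment_shift nz_c nz_h mom le_h.
by rewrite pactM h0 pact0l mul0mx mxE eqxx.
Qed.

Definition comp_mx n (p : {poly F}) : 'M[F]_n :=
  \matrix_(i < n, j < n) if i.+1 == n then - p`_j else (i.+1 == j)%:R.

Lemma krylov_comp d n (v : 'rV[F]_n) (M : 'M[F]_n) p :
  p \is monic -> size p = d.+1 -> pact v M p = 0 ->
  krylov d v M *m M = comp_mx d p *m krylov d v M.
Proof.
move=> mon_p sz_p p0; apply/row_matrixP => i; rewrite !row_mul.
rewrite [RHS]mulmx_sum_row rowK -mulmxA -[M ^+ i *m M]/(M ^+ i * M) -exprSr.
have [eq_i | neq_i] := eqVneq i.+1 d.
  move: p0; rewrite (@pact_wide _ _ _ d.+1) ?sz_p // big_ord_recr /=.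
  have -> : p`_d = 1 by rewrite -[d]/d.+1.-1 -sz_p -lead_coefE (monicP mon_p).
  rewrite scale1r addrC eq_i => /eqP; rewrite addr_eq0 => /eqP ->.
  rewrite -sumrN; apply: eq_bigr => j _.
  by rewrite !mxE eq_i eqxx rowK scaleNr.
have lt_i : (i.+1 < d)%N by rewrite ltn_neqAle neq_i ltn_ord.
rewrite (bigD1 (Ordinal lt_i)) //= big1 ?addr0 => [|j neq_j].
  by rewrite !mxE (negPf neq_i) eqxx scale1r rowK.
by rewrite !mxE (negPf neq_i) -[i.+1]/(nat_of_ord (Ordinal lt_i)) val_eqE
  eq_sym (negPf neq_j) scale0r.
Qed.

Lemma krylov_similar n (v : 'rV[F]_n) (M : 'M[F]_n) p :
  krylov n v M \in unitmx -> p \is monic -> size p = n.+1 -> pact v M p = 0 ->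
  similar_mx M (comp_mx n p).
Proof. by move=> uK mon_p sz_p /(krylov_comp mon_p sz_p); apply: similar_unit. Qed.

Lemma cyclic_similar_comp n (M : 'M[F]_n) :
  cyclic_mx M -> similar_mx M (comp_mx n (char_poly M)).
Proof.
case=> v uK; apply: krylov_similar uK (char_poly_monic M) (size_char_poly M) _.
exact: pact_char_poly.
Qed.

(** The matrix of M in a Krylov basis is the companion matrix of its
    characteristic polynomial. *)
Lemma cyclic_similar m n (A : 'M[F]_m) (B : 'M[F]_n) :
  cyclic_mx A -> cyclic_mx B -> char_poly A = char_poly B -> similar_mx A B.
Proof.
move=> /cyclic_similar_comp sA /cyclic_similar_comp sB eAB.
have mn : m = n by apply: succn_inj; rewrite -(size_char_poly A) eAB size_char_poly.
subst m; rewrite eAB in sA.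
exact: similar_trans sA (similar_sym sB).
Qed.

Lemma char_poly_comp n p :
  p \is monic -> size p = n.+1 -> char_poly (comp_mx n p) = p.
Proof.
move=> mon_p sz_p; have en : n = (size p).-1 by rewrite sz_p.
rewrite -[RHS]companionmxK //; move: sz_p; rewrite {}en => sz_p.
congr (char_poly _); apply/matrixP => i j; rewrite !mxE.
have := ltn_ord i; move: (nat_of_ord i) => k ltk.
by have -> : (k.+1 == (size p).-1) = (k == (size p).-1.-1) by lia.
Qed.

(** The index is a natural number, so that [evec n i.+1] requires no proof;
    vectors with an index beyond n are 0. *)
Definition evec n (i : nat) : 'rV[F]_n := \row_(j < n) (i == j)%:R.

Lemma evec_mulE m n (A : 'M[F]_(m, n)) (i : 'I_m) : evec m i *m A = row i A.
Proof.
rewrite mulmx_sum_row (bigD1 i) //= mxE eqxx scale1r big1 ?addr0 // => j ji.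
by rewrite mxE val_eqE eq_sym (negPf ji) scale0r.
Qed.

Lemma evec_comp n p i : (i.+1 < n)%N -> evec n i *m comp_mx n p = evec n i.+1.
Proof.
move=> lt_i; have -> := evec_mulE (comp_mx n p) (Ordinal (ltnW lt_i)).
by apply/rowP => j; rewrite !mxE /= ltn_eqF.
Qed.

Lemma evec_comp_exp n p i j : (j + i < n)%N ->
  evec n j *m comp_mx n p ^+ i = evec n (j + i).
Proof.
elim: i => [|i IHi] lt_i; first by rewrite mulmx1 addn0.
rewrite exprSr -[_ * _]/(_ *m _) mulmxA IHi ?evec_comp ?addnS //; lia.
Qed.

Lemma krylov_evec_comp n p : krylov n (evec n 0) (comp_mx n p) = 1%:M.
Proof.
apply/row_matrixP => i; rewrite rowK evec_comp_exp add0n ?ltn_ord //.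
by apply/rowP => j; rewrite !mxE val_eqE.
Qed.

Lemma cyclic_comp n p : cyclic_mx (comp_mx n p).
Proof. by exists (evec n 0); rewrite krylov_evec_comp unitmx1. Qed.

Lemma char_poly_block m n (A : 'M[F]_m) (B : 'M[F]_n) :
  char_poly (block_mx A 0 0 B) = char_poly A * char_poly B.
Proof. by rewrite /char_poly char_block_diag_mx det_ublock. Qed.

(** A polynomial that kills (u, v) is a multiple of both characteristic
    polynomials, hence of their product. *)
Lemma cyclic_block m n (A : 'M[F]_m) (B : 'M[F]_n) :
  cyclic_mx A -> cyclic_mx B -> coprimep (char_poly A) (char_poly B) ->
  cyclic_mx (block_mx A 0 0 B).
Proof.
move=> [u uA] [v vB] co; exists (row_mx u v); apply/krylov_unitP => h le_h.
rewrite pact_block -row_mx0 => /eq_row_mx[hu hv].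
have dA := pact_cyclic_dvd uA (char_poly_monic A) (size_char_poly A) (pact_char_poly A u) hu.
have dB := pact_cyclic_dvd vB (char_poly_monic B) (size_char_poly B) (pact_char_poly B v) hv.
have dAB : char_poly A * char_poly B %| h by rewrite Gauss_dvdp ?dA.
apply/eqP; apply: contraLR le_h => nz_h; rewrite -ltnNge.
apply: leq_trans (dvdp_leq nz_h dAB).
rewrite size_mul ?monic_neq0 ?char_poly_monic // !size_char_poly; lia.
Qed.

Lemma det_comp n p : p \is monic -> size p = n.+1 ->
  \det (comp_mx n p) = (-1) ^+ n * p`_0.
Proof.
move=> mon_p sz_p; rewrite -{2}(char_poly_comp mon_p sz_p) char_poly_det.
by rewrite mulrA -expr2 sqrr_sign mul1r.
Qed.
End Cyclic.

(** * Attaching a cyclic block *)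

Section Extension.
Variable F : fieldType.

Lemma sum_row_mx m n (I : Type) (r : seq I) (P : pred I)
    (a : I -> 'rV[F]_m) (b : I -> 'rV[F]_n) :
  \sum_(i <- r | P i) row_mx (a i) (b i) =
  row_mx (\sum_(i <- r | P i) a i) (\sum_(i <- r | P i) b i).
Proof.
by elim/big_rec3: _ => [|i x y z _ ->]; rewrite ?row_mx0 // add_row_mx.
Qed.

Lemma sum_ord_last (V : zmodType) n (a : nat -> V) : (0 < n)%N ->
  \sum_(i < n) a i = \sum_(i < n.-1) a i + a n.-1.
Proof. by case: n => // n _; rewrite big_ord_recr. Qed.

Lemma drop_poly_recl (p : {poly F}) j :
  drop_poly j p = (p`_j)%:P + drop_poly j.+1 p * 'X.
Proof.
apply/polyP => i; rewrite coefD coefMX coefC !coef_drop_poly.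
case: i => [|i] /=; first by rewrite add0n addr0.
by rewrite add0r; congr (p`_ _); lia.
Qed.

Lemma monic_split n (p : {poly F}) : p \is monic -> size p = n.+1 ->
  p = 'X^n + take_poly n p.
Proof.
move=> mon_p sz_p; rewrite addrC -[LHS](poly_take_drop n); congr (_ + _).
suff -> : drop_poly n p = 1 by rewrite mul1r.
apply/polyP => -[|i]; rewrite coef_drop_poly coef1 /=.
  by rewrite add0n -[n]/n.+1.-1 -sz_p -lead_coefE (monicP mon_p).
by rewrite nth_default // sz_p; lia.
Qed.

Lemma evec_comp_last d (p : {poly F}) : (0 < d)%N ->
  evec F d d.-1 *m comp_mx d p = - \sum_(i < d) p`_i *: evec F d i.
Proof.
move=> d0; have ltd : (d.-1 < d)%N by lia.
have -> := evec_mulE (comp_mx d p) (Ordinal ltd).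
rewrite -sumrN; apply/rowP => j; rewrite !mxE /= prednK // eqxx summxE.
rewrite (bigD1 j) //= big1 => [|i ij]; rewrite !mxE.
  by rewrite eqxx mulr1 addr0.
by rewrite val_eqE (negPf ij) mulr0 oppr0.
Qed.

(** The matrix A of size m has a generator g, whose Krylov sequence takes the
    values 0, ..., 0, 1 under phi and which satisfies P(A) g = 0.  A companion
    block with polynomial p is attached: phi sends the old part to the second
    vector [evec d 1] of the block, and the row j of X sends the block back to
    the vector h_j(A) g.  As the first row of X is 0, [evec d 1] is the image
    under K of u_0 = [evec d 0], so that P(K) g = u_0 K ([ext_link]).
    On the other hand p(K) u_0 is a combination of the feedback vectors
    ([ext_cycle]), that is, some S(K) g.  Hence P p - 'X S kills g, and even its
    preimage under K, which is the generator used for the next block. *)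
Section Core.
Variables (m d : nat) (A : 'M[F]_m) (phi : 'cV[F]_m) (g : 'rV[F]_m).
Variables (P p : {poly F}) (X : 'M[F]_(d, m)) (h : nat -> {poly F}).
Implicit Type q : {poly F}.
Hypotheses (m_gt0 : (0 < m)%N) (d_gt1 : (1 < d)%N).
Hypotheses (P_monic : P \is monic) (P_size : size P = m.+1) (P0 : P`_0 != 0).
Hypotheses (p_monic : p \is monic) (p_size : size p = d.+1).
Hypothesis A_mom :
  forall i, (i < m)%N -> (g *m A ^+ i *m phi) 0 0 = (i.+1 == m)%:R.
Hypothesis gP : pact g A P = 0.
Hypothesis h_size : forall j, (size (h j) <= m)%N.
Hypothesis h0 : h 0 = 0.
Hypothesis XE : forall j, (j < d)%N -> evec F d j *m X = pact g A (h j).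

Let K := block_mx A (phi *m evec F d 1) X (comp_mx d p).
Local Notation u i := (row_mx (0 : 'rV[F]_m) (evec F d i)).
Let g1 : 'rV[F]_(m + d) := row_mx g 0.

Lemma ext_pow i : (i < m)%N -> g1 *m K ^+ i = row_mx (g *m A ^+ i) 0.
Proof.
elim: i => [|i IHi] lt_i; first by rewrite !mulmx1.
rewrite exprSr -[_ * _]/(_ *m _) mulmxA IHi 1?ltnW // mul_row_block !mul0mx !addr0.
rewrite -mulmxA -[A ^+ i *m A]/(A ^+ i * A) -exprSr mulmxA.
suff -> : g *m A ^+ i *m phi = 0 by rewrite mul0mx.
apply/matrixP => a b; rewrite !ord1 A_mom ?(ltnW lt_i) // mxE.
by rewrite ltn_eqF.
Qed.

Lemma ext_pact q : (size q <= m)%N -> pact g1 K q = row_mx (pact g A q) 0.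
Proof.
move=> le_q; rewrite !(@pact_wide _ _ _ m) //.
rewrite (eq_bigr (fun i : 'I_m => row_mx (q`_i *: (g *m A ^+ i)) (0 : 'rV[F]_d))).
  by rewrite sum_row_mx big1_eq.
by move=> i _; rewrite ext_pow // scale_row_mx scaler0.
Qed.

Lemma ext_pow_full : g1 *m K ^+ m = row_mx (g *m A ^+ m) (evec F d 1).
Proof.
suff e k : k.+1 = m ->
    g1 *m K ^+ k.+1 = row_mx (g *m A ^+ k.+1) (evec F d 1).
  by have := e _ (prednK m_gt0); rewrite prednK.
move=> ek; have lt_k : (k < m)%N by rewrite -ek.
rewrite exprSr -[_ * _]/(_ *m _) mulmxA ext_pow // mul_row_block !mul0mx !addr0.
rewrite exprSr -[A ^+ _ * A]/(_ *m _) !mulmxA; congr row_mx.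
by rewrite [g *m _ *m phi]mx11_scalar A_mom // ek eqxx mul1mx.
Qed.

Lemma ext_link : pact g1 K P = u 1.
Proof.
rewrite (monic_split P_monic P_size) pactD.
rewrite [pact _ _ (take_poly _ _)]ext_pact ?size_take_poly // pact_Xn.
rewrite ext_pow_full add_row_mx addr0; congr row_mx.
by rewrite -pact_Xn -pactD -monic_split.
Qed.

Lemma ext_step j : (j.+1 < d)%N -> u j *m K = pact g1 K (h j) + u j.+1.
Proof.
move=> lt_j; rewrite mul_row_block !mul0mx !add0r ext_pact // XE ?(ltnW lt_j) //.
by rewrite evec_comp // add_row_mx addr0 add0r.
Qed.

Lemma ext_last :
  u d.-1 *m K = pact g1 K (h d.-1) - \sum_(i < d) p`_i *: u i.
Proof.
rewrite mul_row_block !mul0mx !add0r ext_pact // XE; last by lia.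
rewrite evec_comp_last 1?ltnW // (eq_bigr (fun i : 'I_d => row_mx 0 (p`_i *: evec F d i))).
  by rewrite sum_row_mx big1_eq opp_row_mx add_row_mx oppr0 add0r addr0.
by move=> i _; rewrite scale_row_mx scaler0.
Qed.

(** Horner's scheme for p(K) u_0: each step consumes one coefficient of p and
    replaces u_j K by u_(j+1) plus a feedback vector. *)
Lemma ext_cycle_partial j : (j < d)%N ->
  pact (u 0) K p = \sum_(i < j) p`_i *: u i + pact (u j) K (drop_poly j p)
    + pact g1 K (\sum_(i < j) h i * drop_poly i.+1 p).
Proof.
elim: j => [|j IHj] lt_j.
  by rewrite !big_ord0 pact0 add0r addr0 drop_poly0l.
rewrite IHj 1?ltnW // !big_ord_recr /= drop_poly_recl pactD pactC pact_MX.
rewrite -pact_mull ext_step // pactDl -pactM pactD.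
rewrite -!addrA; congr (_ + (_ + _)).
rewrite addrCA; congr (_ + _); exact: addrC.
Qed.

Lemma ext_cycle :
  pact (u 0) K p = pact g1 K (\sum_(j < d) h j * drop_poly j.+1 p).
Proof.
have lt_d : (d.-1 < d)%N by lia.
have dE : d = d.-1.+1 by lia.
have drop1 : drop_poly d p = 1.
  apply/polyP => -[|i]; rewrite coef_drop_poly coef1 /=.
    by rewrite add0n -[d]/d.+1.-1 -p_size -lead_coefE (monicP p_monic).
  by rewrite nth_default // p_size; lia.
rewrite (ext_cycle_partial lt_d) drop_poly_recl -dE drop1 mul1r pactD pactC pact_X.
rewrite ext_last.
rewrite (sum_ord_last (fun j => h j * drop_poly j.+1 p) (ltnW d_gt1)).
rewrite (sum_ord_last (fun j => p`_j *: u j) (ltnW d_gt1)).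
rewrite -dE drop1 mulr1 pactD [LHS]addrC; congr (_ + _).
by rewrite addrA [LHS]addrC subrK.
Qed.

(** The preimage of g under K, as computed from P(K) g = u_0 K; this formula
    dispenses with the invertibility of K. *)
Definition ext_gen : 'rV[F]_(m + d) :=
  (P`_0)^-1 *: (u 0 - pact g1 K (drop_poly 1 P)).
Definition ext_phi : 'cV[F]_(m + d) := col_mx 0 (evec F d d.-1)^T.

Lemma u0K : u 0 *m K = u 1.
Proof. by rewrite ext_step // h0 pact0 add0r. Qed.

Let P_tail : P - drop_poly 1 P * 'X = (P`_0)%:P.
Proof. by rewrite -{1}[P]drop_poly0l drop_poly_recl addrK. Qed.

Lemma ext_gen_mul : ext_gen *m K = g1.
Proof.
rewrite -scalemxAl mulmxBl u0K -ext_link -pact_MX -pactB.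
by rewrite P_tail pactC scalerA mulVf // scale1r.
Qed.

Lemma ext_gen_link : pact ext_gen K P = u 0.
Proof.
rewrite pactZl pactDl -[- pact _ _ _]scaleN1r pactZl scaleN1r -pactM mulrC pactM.
rewrite ext_link -u0K pact_mull -pact_MX -pactB.
by rewrite P_tail pactC scalerA mulVf // scale1r.
Qed.

Lemma ext_annihilated :
  pact ext_gen K (P * p - 'X * \sum_(j < d) h j * drop_poly j.+1 p) = 0.
Proof.
by rewrite pactB !pactM ext_gen_link pact_X ext_gen_mul ext_cycle subrr.
Qed.

(** A feedback vector of the old part is one for the new part, with its
    polynomial multiplied by X since the generator is now g K^-1. *)
Lemma ext_window q : (size q <= m)%N ->
  pact ext_gen K ('X * q) = row_mx (pact g A q) 0.
Proof. by move=> le_q; rewrite pactM pact_X ext_gen_mul ext_pact. Qed.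

Let coor (y : 'rV[F]_(m + d)) k := (rsubmx y *m (evec F d k)^T) 0 0.

Lemma coorE y (k : 'I_d) : coor y k = rsubmx y 0 k.
Proof.
rewrite /coor mxE (bigD1 k) //= big1 => [|i ik]; rewrite !mxE.
  by rewrite eqxx mulr1 addr0.
by rewrite eq_sym (_ : (i == k :> nat) = false) ?mulr0 //; apply: negPf.
Qed.

Lemma coor_shift y k : (k.+2 < d)%N -> coor y d.-1 = 0 ->
  coor (y *m K) k.+2 = coor y k.+1.
Proof.
move=> lt_k; have lt_d : (d.-1 < d)%N by lia.
rewrite -[d.-1]/(nat_of_ord (Ordinal lt_d)) -[k.+2]/(nat_of_ord (Ordinal lt_k)).
rewrite -[k.+1]/(nat_of_ord (Ordinal (ltnW lt_k))) !coorE => y0.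
rewrite -[y in y *m K]hsubmxK mul_row_block row_mxKr !mxE.
rewrite [X in X + _]big1 ?add0r => [|i _]; last first.
  by rewrite !mxE big_ord1 mxE mulr0 mulr0.
rewrite (bigD1 (Ordinal (ltnW lt_k))) //= big1 => [|j jk].
  by rewrite !mxE /= ltn_eqF // eqxx mulr1 addr0.
rewrite !mxE /=; case: eqP => [jd|_].
  have -> : j = Ordinal lt_d by apply: val_inj => /=; lia.
  by move: y0; rewrite mxE => ->; rewrite mul0r.
by rewrite eqSS (_ : (j == k.+1 :> nat) = false) ?mulr0 //; apply: negPf.
Qed.
(** Past m steps the sequence has entered the block, and each further step moves
    its last nonzero coordinate by exactly one position. *)
Lemma ext_coor j : (j.+1 < d)%N ->
  coor (g1 *m K ^+ (m + j)) j.+1 = 1 /\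
  forall k, (j.+1 < k < d)%N -> coor (g1 *m K ^+ (m + j)) k = 0.
Proof.
elim: j => [|j IHj] lt_j.
  have coor1 k : coor (g1 *m K ^+ (m + 0)) k = (evec F d 1 *m (evec F d k)^T) 0 0.
    by rewrite addn0 /coor ext_pow_full row_mxKr.
  split=> [|k /andP[lt1 ltd]]; rewrite coor1 mxE.
    rewrite (bigD1 (Ordinal d_gt1)) //= big1 ?addr0 ?mxE ?eqxx ?mulr1 // => i i1.
    by rewrite !mxE eq_sym (_ : (i == 1 :> nat) = false) ?mul0r //; apply: negPf.
  rewrite big1 // => i _; rewrite !mxE; case: eqP => [<-|_]; last by rewrite mul0r.
  by rewrite gtn_eqF ?mulr0.
have [IH1 IH0] := IHj (ltnW lt_j); rewrite addnS exprSr -[_ * _]/(_ *m _) mulmxA.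
have y0 : coor (g1 *m K ^+ (m + j)) d.-1 = 0 by apply: IH0; lia.
split=> [|[|[|k]] /andP[lt_k ltd]]; rewrite ?coor_shift //.
by apply: IH0; lia.
Qed.

Lemma ext_phiE y : (y *m ext_phi) 0 0 = coor y d.-1.
Proof. by rewrite -{1}[y]hsubmxK mul_row_col mulmx0 add0r. Qed.

Lemma ext_moment i : (i < m + d)%N ->
  (ext_gen *m K ^+ i *m ext_phi) 0 0 = (i.+1 == (m + d)%N)%:R.
Proof.
case: i => [|i] lt_i.
  rewrite mulmx1 -scalemxAl mulmxBl ext_pact; last first.
    by rewrite size_drop_poly P_size subn1.
  rewrite !mul_row_col !(mulmx0, mul0mx, add0r, addr0, subr0) 2!mxE.
  rewrite big1 ?mulr0 => [|j _]; last first.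
    rewrite !mxE; case: eqP => [<-|_]; last by rewrite mul0r.
    by rewrite (_ : (d.-1 == 0%N) = false) ?mulr0 //; lia.
  by rewrite (_ : (1 == m + d)%N = false) //; lia.
rewrite exprS -[_ * _]/(_ *m _) mulmxA ext_gen_mul ext_phiE.
have [lt_im | le_mi] := ltnP i m.
  rewrite ext_pow // /coor row_mxKr mul0mx mxE.
  by rewrite (_ : (i.+2 == m + d)%N = false) //; lia.
have [ltj | lej] := ltnP (i - m).+2 d.
  have [_ e0] := ext_coor (ltnW ltj); move: e0; rewrite subnKC // => ->; last by lia.
  by rewrite (_ : (i.+2 == m + d)%N = false) //; lia.
have ltj : ((i - m).+1 < d)%N by lia.
have [e1 _] := ext_coor ltj; move: e1; rewrite subnKC //.
have -> : (i - m).+1 = d.-1 by lia.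
by move=> ->; rewrite (_ : (i.+2 == m + d)%N) //; lia.
Qed.
End Core.

(** K is a candidate for T^-1 M with T quadratic for delta: see
    [completion_factor].  The values of phi make g a cyclic vector of K, so that
    R is the characteristic polynomial.  As phi vanishes on W, it may be used to
    modify K on the whole space without changing it on W. *)
Definition completion n w (delta : F) (M : 'M[F]_n) (W : 'M[F]_(w, n))
    (phi : 'cV[F]_n) (R : {poly F}) (K : 'M[F]_n) (g : 'rV[F]_n) : Prop :=
  [/\ W *m phi = 0 /\ W *m K = W *m M, (K - delta *: M <= W *m M)%MS,
      forall i, (i < n)%N -> (g *m K ^+ i *m phi) 0 0 = (i.+1 == n)%:R
    & pact g K R = 0].

(** If M is [sgn_mx] times a companion matrix K, then K agrees with M on the
    first basis vector and with delta M on the others; thus K itself is the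
    candidate that replaces M on such a block. *)
Definition sgn_mx d (delta : F) : 'M[F]_d :=
  diag_mx (\row_(j < d) if j == 0%N :> nat then 1 else delta).

Lemma evec_sgn d delta : (0 < d)%N -> evec F d 0 *m sgn_mx d delta = evec F d 0.
Proof.
case: d => // d _; rewrite (evec_mulE _ (0 : 'I_d.+1)).
by apply/rowP => j; rewrite !mxE /= -val_eqE /=; case: eqP => // <-.
Qed.

Section CompletionExt.
Variables (m w d : nat) (delta : F) (M : 'M[F]_m) (W : 'M[F]_(w, m)).
Variables (phi : 'cV[F]_m) (P : {poly F}) (A : 'M[F]_m) (g : 'rV[F]_m).
Variables (p : {poly F}) (eta : F) (h : nat -> {poly F}).
Hypotheses (m_gt0 : (0 < m)%N) (d_gt1 : (1 < d)%N).
Hypotheses (delta2 : delta * delta = 1).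
Hypotheses (P_monic : P \is monic) (P_size : size P = m.+1) (P0 : P`_0 != 0).
Hypotheses (p_monic : p \is monic) (p_size : size p = d.+1).
Hypothesis cfg : completion delta M W phi P A g.
Hypothesis h_size : forall j, (size (h j) <= m)%N.
Hypothesis h0 : h 0 = 0.
Hypothesis h_sub : forall j, (pact g A (h j) <= W *m M)%MS.

Let q := p - eta *: 'X.
Let X : 'M[F]_(d, m) := \matrix_(j < d) pact g A (h j).
Let K := block_mx A (phi *m evec F d 1) X (comp_mx d q).
Let M' := block_mx M 0 0 (sgn_mx d delta *m comp_mx d p).
Let W' := col_mx (row_mx W 0) (row_mx (0 : 'rV_m) (evec F d 0)).
Let g' := @ext_gen m d A phi g P q X.
Let phi' := @ext_phi m d.

Let q_size : size q = d.+1.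
Proof.
rewrite size_polyDl // size_polyN p_size (leq_ltn_trans (size_scale_leq _ _)) //.
by rewrite size_polyX ltnS.
Qed.

Let q_monic : q \is monic.
Proof.
rewrite monicE lead_coefDl ?(monicP p_monic) // size_polyN p_size.
by rewrite (leq_ltn_trans (size_scale_leq _ _)) // size_polyX ltnS.
Qed.

Let XE j : (j < d)%N -> evec F d j *m X = pact g A (h j).
Proof. by move=> lt_j; rewrite (evec_mulE _ (Ordinal lt_j)) rowK. Qed.

Let WM' : W' *m M' = col_mx (row_mx (W *m M) 0) (row_mx 0 (evec F d 1)).
Proof.
rewrite mul_col_mx !mul_row_block !(mulmx0, mul0mx, addr0, add0r) mulmxA.
by rewrite evec_sgn ?evec_comp // ltnW.
Qed.

Let sub_left k (x : 'M[F]_(k, m)) :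
  (x <= W *m M)%MS -> (row_mx x (0 : 'M_(k, d)) <= W' *m M')%MS.
Proof.
case/submxP => D ->; rewrite WM'; apply/submxP; exists (row_mx D 0).
by rewrite mul_row_col mul0mx addr0 mul_mx_row mulmx0.
Qed.

Let sub_right k (c : 'cV[F]_k) :
  (row_mx (0 : 'M_(k, m)) (c *m evec F d 1) <= W' *m M')%MS.
Proof.
rewrite WM'; apply/submxP; exists (row_mx 0 c).
by rewrite mul_row_col mul0mx add0r mul_mx_row mulmx0.
Qed.

Let comp_diff : comp_mx d q - delta *: (sgn_mx d delta *m comp_mx d p) =
  (\col_j ((if j == 0%N :> nat then 1 - delta else 0)
     + (if j.+1 == d then eta else 0))) *m evec F d 1.
Proof.
apply/matrixP => i j; rewrite mul_diag_mx !mxE big_ord1 !mxE.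
rewrite !coefB !coefZ !coefX.
case: (altP (i.+1 =P d)) => [eq_i | ne_i].
  have -> : (i == 0%N :> nat) = false by apply/eqP => i0; move: d_gt1; rewrite -eq_i i0.
  rewrite mulrA delta2 mul1r add0r opprD opprK addrAC.
  by rewrite [1%N == _]eq_sym; ring.
rewrite addr0; case: (nat_of_ord i =P 0%N) => [->|_].
  by rewrite mul1r -[X in X - _]mul1r -mulrBl.
by rewrite mul0r mulrA delta2 mul1r subrr.
Qed.

(** On the new block W is the line of u_0, so that W M contains u_0 M = [evec d 1].
    The link from phi to this vector is therefore allowed, and so is the change
    of the linear coefficient of p by eta. *)
Lemma completion_ext : completion delta M' W' phi'
  (P * q - 'X * \sum_(j < d) h j * drop_poly j.+1 q) K g'.
Proof.
case: cfg => -[Wphi WK] KM mom gP; split.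
- split.
    rewrite mul_col_mx !mul_row_col !(mulmx0, mul0mx, add0r).
    rewrite -[0 in RHS]col_mx0; congr col_mx; apply/matrixP => a b.
    rewrite !mxE big1 // => j _; rewrite !mxE; case: eqP => [<-|_]; last by rewrite mul0r.
    by rewrite (_ : (d.-1 == 0%N) = false) ?mulr0 //; lia.
  rewrite WM' mul_col_mx !mul_row_block !(mulmx0, mul0mx, addr0, add0r) mulmxA.
  by rewrite Wphi mul0mx WK XE ?(ltnW d_gt1) // h0 pact0 evec_comp.
- rewrite scale_block_mx opp_block_mx add_block_mx !scaler0 !subr0 comp_diff.
  rewrite /block_mx col_mx_sub; apply/andP; split.
    rewrite -[A - _]addr0 -[phi *m _]add0r -add_row_mx.
    by rewrite addmx_sub ?sub_left ?sub_right.
  rewrite -[X]addr0 -[_ *m evec F d 1]add0r -add_row_mx.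
  rewrite addmx_sub ?sub_right // sub_left //; apply/row_subP => j; rewrite rowK.
  exact: h_sub.
- by move=> i lt_i; apply: ext_moment.
- exact: ext_annihilated.
Qed.

Lemma completion_ext_window (r : {poly F}) : (size r <= m)%N ->
  (pact g A r <= W *m M)%MS -> (pact g' K ('X * r)%R <= W' *m M')%MS.
Proof.
move=> le_r sub_r; case: cfg => _ _ mom gP.
by rewrite (@ext_window _ _ _ _ _ _ _ _ h) //; apply: sub_left.
Qed.

Lemma completion_ext_link : (pact g' K ('X * P)%R <= W' *m M')%MS.
Proof.
case: cfg => _ _ mom gP.
rewrite mulrC pactM (@ext_gen_link _ _ _ _ _ _ _ _ h) // pact_X.
rewrite (@u0K _ _ _ _ g _ _ h) //.
by rewrite -[evec F d 1]mul1mx sub_right.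
Qed.
End CompletionExt.
End Extension.

(** * Prescribing the characteristic polynomial *)

Section Flexible.
Variable F : fieldType.
Implicit Types p q R u a b : {poly F}.

(** For 0 < j < d the quotients of p by X^(j+1) have the degrees d-2, ..., 0, each
    of them once. *)
Lemma drop_poly_span d p (a : {poly F}) : p \is monic -> size p = d.+1 ->
  (size a < d)%N ->
  exists2 c : nat -> F, c 0 = 0 & a = \sum_(j < d) c j *: drop_poly j.+1 p.
Proof.
move=> mon_p sz_p; have [k le_k] := ubnP (size a).
elim: k a le_k => // k IHk a; rewrite ltnS => le_k lt_a.
have [a0 | nz_a] := eqVneq a 0.
  by exists (fun=> 0) => //; rewrite a0 big1 // => j _; rewrite scale0r.
have sa : (0 < size a)%N by rewrite size_poly_gt0.
have [l [lE l0 ld]] : exists l, [/\ (l.+1 + size a = d.+1)%N, (0 < l)%N & (l < d)%N].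
  by exists (d - size a)%N; split; lia.
pose b := a - lead_coef a *: drop_poly l.+1 p.
have sdrop : size (drop_poly l.+1 p) = size a by rewrite size_drop_poly sz_p; lia.
have ldrop : lead_coef (drop_poly l.+1 p) = 1.
  rewrite lead_coefE sdrop coef_drop_poly -(monicP mon_p) lead_coefE sz_p.
  by congr (p`_ _); lia.
have lt_b : (size b < size a)%N.
  rewrite ltnNge; apply/negP => le_ab; have sb : size b = size a.
    apply/eqP; rewrite eqn_leq le_ab andbT.
    rewrite (leq_trans (size_polyD _ _)) // size_polyN geq_max leqnn.
    by rewrite (leq_trans (size_scale_leq _ _)) ?sdrop.
  have : b`_(size b).-1 = 0.
    move: ldrop; rewrite sb coefB coefZ !lead_coefE sdrop => ->.
    by rewrite mulr1 subrr.
  move/eqP; rewrite -lead_coefE lead_coef_eq0 => /eqP b0.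
  by move: sa; rewrite -sb b0 size_poly0.
have [||c c0 bE] := IHk b; try lia.
exists (fun j => c j + (if j == l then lead_coef a else 0)).
  by rewrite c0 add0r [0%N == l]eq_sym gtn_eqF.
rewrite (eq_bigr (fun j : 'I_d => c j *: drop_poly j.+1 p +
    (if j == l :> nat then lead_coef a else 0) *: drop_poly j.+1 p)); last first.
  by move=> j _; rewrite scalerDl.
rewrite big_split -bE (bigD1 (Ordinal ld)) //= eqxx big1 ?addr0 ?subrK // => j jl.
by rewrite (_ : (j == l :> nat) = false) ?scale0r //; apply: negPf.
Qed.

(** Modulo p, X a is an arbitrary polynomial of size at most d without constant
    coefficient, so only the constant 1 has to be reached.  If d = 2, then
    X^2 + e is congruent to e - p(0) modulo p and X a.  If d > 2 and e <> 0, then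
    X^2 + e is congruent to e modulo X a.  If e = 0, then X^d, which is
    congruent to - p(0) modulo p and X a, is a multiple of X^2. *)
Lemma window_mod d p e u : p \is monic -> size p = d.+1 -> (1 < d)%N ->
  p`_0 != 0 -> (d = 2 -> p`_0 != e) ->
  exists a b, [/\ (size a < d)%N, (size b < d)%N
    & p %| u - ('X * a + ('X^2 + e%:P) * b)].
Proof.
move=> mon_p sz_p d1 p0 pe.
have [a1 [b1 [sa1 sb1 dvd1]]] : exists a b, [/\ (size a < d)%N, (size b < d)%N
    & p %| 1 - ('X * a + ('X^2 + e%:P) * b)].
  (* p = X^2 + p1 X + p0, so that 1 = ((X^2 + e) + p1 X - p) / (e - p0). *)
  have [d2 | d2] := eqVneq d 2.
    have nz : e - p`_0 != 0 by rewrite subr_eq0 eq_sym pe.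
    exists (p`_1 / (e - p`_0))%:P, (e - p`_0)^-1%:P.
    rewrite !d2 !(leq_ltn_trans (size_polyC_leq1 _)) //; split=> //.
    suff -> : 1 - ('X * (p`_1 / (e - p`_0))%:P + ('X^2 + e%:P) * (e - p`_0)^-1%:P)
       = p * (- ((e - p`_0)^-1)%:P) by apply: dvdp_mulr.
    have pE : p = 'X^2 + (p`_1)%:P * 'X + (p`_0)%:P.
      rewrite -{1}[p]drop_poly0l drop_poly_recl drop_poly_recl.
      have -> : drop_poly 2 p = 1.
        apply/polyP => -[|i]; rewrite coef_drop_poly coef1 /=.
          by rewrite -(monicP mon_p) lead_coefE sz_p d2.
        by rewrite nth_default // sz_p; lia.
      by ring.
    have inv1 : (e%:P - (p`_0)%:P) * ((e - p`_0)^-1)%:P = 1.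
      by rewrite -polyCB -polyCM mulfV.
    move: inv1 pE; rewrite polyCM; move: (_^-1)%:P (p`_0)%:P (p`_1)%:P => i c0 c1 inv1 ->.
    by rewrite -inv1; ring.
  have [e0 | nz_e] := eqVneq e 0.
    pose r := drop_poly 1 (take_poly d p).
    have pE : p = 'X^d + ((p`_0)%:P + r * 'X).
      rewrite {1}(monic_split mon_p sz_p) -[take_poly d p]drop_poly0l drop_poly_recl.
      by rewrite coef_take_poly ltnW.
    have sr : (size r < d)%N.
      rewrite size_drop_poly; have := size_take_poly d p; lia.
    exists (- (p`_0)^-1 *: r), (- (p`_0)^-1 *: 'X^(d - 2)).
    rewrite !(leq_ltn_trans (size_scale_leq _ _)) ?size_polyXn //; try lia.
    split=> //; rewrite e0 addr0 -!mul_polyC.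
    suff -> : 1 - ('X * ((- (p`_0)^-1)%:P * r) + 'X^2 * ((- (p`_0)^-1)%:P * 'X^(d - 2)))
       = p * ((p`_0)^-1)%:P by apply: dvdp_mulr.
    have -> : 'X^2 * ((- (p`_0)^-1)%:P * 'X^(d - 2)) = - ((p`_0)^-1)%:P * 'X^d.
      by rewrite mulrCA -exprD subnKC // polyCN.
    have inv1 : (p`_0)%:P * ((p`_0)^-1)%:P = 1 by rewrite -polyCM mulfV.
    move: inv1 pE; rewrite polyCN; move: (_^-1)%:P (p`_0)%:P => i c0 inv1 ->.
    by rewrite -inv1; ring.
  exists (- e^-1 *: 'X), (e^-1%:P).
  rewrite (leq_ltn_trans (size_scale_leq _ _)) ?size_polyX; last lia.
  rewrite (leq_ltn_trans (size_polyC_leq1 _)) //; split=> //.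
  suff -> : 1 - ('X * (- e^-1 *: 'X) + ('X^2 + e%:P) * (e^-1)%:P) = 0 by apply: dvdp0.
  have inv1 : e%:P * (e^-1)%:P = 1 by rewrite -polyCM mulfV.
  rewrite -mul_polyC polyCN; move: inv1; move: (_^-1)%:P => i inv1.
  by rewrite -inv1; ring.
pose c := (u %% p)`_0; pose r := drop_poly 1 (u %% p).
have uE : u %% p = c%:P + r * 'X by rewrite -drop_poly_recl drop_poly0l.
have sm : (size (u %% p)%R <= d)%N by rewrite -ltnS -sz_p ltn_modp monic_neq0.
have sr : (size r < d)%N by rewrite size_drop_poly; lia.
exists (r + c *: a1), (c *: b1); split.
- rewrite (leq_ltn_trans (size_polyD _ _)) // gtn_max sr.
  by rewrite (leq_ltn_trans (size_scale_leq _ _)).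
- by rewrite (leq_ltn_trans (size_scale_leq _ _)).
rewrite {1}(divp_eq u p) uE -!mul_polyC.
have -> : u %/ p * p + (c%:P + r * 'X) -
   ('X * (r + c%:P * a1) + ('X^2 + e%:P) * (c%:P * b1)) =
   u %/ p * p + c%:P * (1 - ('X * a1 + ('X^2 + e%:P) * b1)) by ring.
by rewrite dvdp_addr ?dvdp_mull ?dvdpp.
Qed.

Lemma size_X2D (e : F) : (size ('X^2 + e%:P)%R <= 3)%N.
Proof.
rewrite (leq_trans (size_polyD _ _)) // geq_max size_polyXn /=.
by rewrite (leq_trans (size_polyC_leq1 _)).
Qed.

Lemma size_window s (e : F) : (size ('X^s * ('X^2 + e%:P))%R <= s.+3)%N.
Proof.
apply: leq_trans (size_polyMleq _ _) _; rewrite size_polyXn addSn /=.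
by rewrite -addn3 leq_add2l size_X2D.
Qed.

(** W, phi and s do not depend on R: the polynomial to be prescribed on M is known
    only when M is part of a larger matrix and the polynomial of the latter is
    given, whereas the feedback vectors are taken in W M once and for all.  These
    have the polynomials X^s X and X^s (X^2 + e); X^s grows with every attached
    block, and e records the obstruction in [window_mod].  The determinant of M
    determines R(0), up to a power of delta. *)
Definition flexible n (delta e : F) (M : 'M[F]_n) : Prop :=
  exists w (W : 'M[F]_(w, n)) (phi : 'cV[F]_n) (s k : nat), (s.+3 <= n)%N /\
  forall R, R \is monic -> size R = n.+1 ->
    R`_0 = (-1) ^+ n * delta ^+ k * \det M ->
  exists K g, [/\ completion delta M W phi R K g,
    (pact g K ('X^(s.+1))%R <= W *m M)%MS
    & (pact g K ('X^s * ('X^2 + e%:P))%R <= W *m M)%MS].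

Definition completable n (delta : F) (M : 'M[F]_n) : Prop :=
  exists k, forall R, R \is monic -> size R = n.+1 ->
    R`_0 = (-1) ^+ n * delta ^+ k * \det M ->
  exists w (W : 'M[F]_(w, n)) (phi : 'cV[F]_n) K g, completion delta M W phi R K g.

Lemma flexible_completable n delta e (M : 'M[F]_n) :
  flexible delta e M -> completable delta M.
Proof.
case=> w [W [phi [s [k [_ flex]]]]]; exists k => R mR sR R0.
by have [K [g []]] := flex R mR sR R0; exists w, W, phi, K, g.
Qed.

Lemma completion_conj n w delta (A P : 'M[F]_n) (W : 'M[F]_(w, n)) phi R K g :
  P \in unitmx -> completion delta A W phi R K g ->
  completion delta (P *m A *m invmx P) (W *m invmx P) (P *m phi) R
    (P *m K *m invmx P) (g *m invmx P).
Proof.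
move=> Pu [[Wphi WK] KM mom gR].
have KP : K *m invmx P = invmx P *m (P *m K *m invmx P).
  by rewrite !mulmxA mulVmx // mul1mx.
have WA : W *m invmx P *m (P *m A *m invmx P) = W *m A *m invmx P.
  by rewrite !mulmxA mulmxKV.
split.
- by rewrite WA !mulmxA !mulmxKV // Wphi WK.
- have -> : P *m K *m invmx P - delta *: (P *m A *m invmx P)
      = P *m (K - delta *: A) *m invmx P.
    by rewrite mulmxBr mulmxBl -scalemxAr -scalemxAl.
  by rewrite WA submxMr // mulmx_sub.
- move=> i lt_i; rewrite -pact_Xn -(pact_morph _ _ KP) pact_Xn.
  by rewrite mulmxA mulmxKV // mom.
- by rewrite -(pact_morph _ _ KP) gR mul0mx.
Qed.

Lemma similar_completable m n delta (A : 'M[F]_m) (B : 'M[F]_n) :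
  similar_mx A B -> completable delta A -> completable delta B.
Proof.
move=> AB; have mn := similar_size AB; subst m; have dAB := similar_det AB.
case: (similarP AB) => P Pu PA [k compl].
have BE : B = P *m A *m invmx P by rewrite PA mulmxK.
exists k => R mR sR; rewrite -dAB => R0.
have [w [W [phi [K [g cfg]]]]] := compl R mR sR R0.
by do 5 eexists; rewrite BE; apply: completion_conj cfg.
Qed.

Lemma similar_flexible m n delta e (A : 'M[F]_m) (B : 'M[F]_n) :
  similar_mx A B -> flexible delta e A -> flexible delta e B.
Proof.
move=> AB; have mn := similar_size AB; subst m; have dAB := similar_det AB.
case: (similarP AB) => P Pu PA [w [W [phi [s [k [le_s flex]]]]]].
have BE : B = P *m A *m invmx P by rewrite PA mulmxK.
exists w, (W *m invmx P), (P *m phi), s, k; split=> // R mR sR R0.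
rewrite -dAB in R0; have [K [g [cfg win1 win2]]] := flex R mR sR R0.
have KP : K *m invmx P = invmx P *m (P *m K *m invmx P).
  by rewrite !mulmxA mulVmx // mul1mx.
exists (P *m K *m invmx P), (g *m invmx P); split.
- by rewrite BE; apply: completion_conj.
- by rewrite -(pact_morph _ _ KP) BE !mulmxA mulmxKV // submxMr.
- by rewrite -(pact_morph _ _ KP) BE !mulmxA mulmxKV // submxMr.
Qed.

Lemma det_sgn_comp d delta p : (0 < d)%N -> p \is monic -> size p = d.+1 ->
  \det (sgn_mx d delta *m comp_mx d p) = delta ^+ d.-1 * ((-1) ^+ d * p`_0).
Proof.
case: d => // d _ mon_p sz_p; rewrite det_mulmx det_comp // det_diag.
congr (_ * _); rewrite big_ord_recl mxE /= mul1r.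
by rewrite (eq_bigr (fun=> delta)) ?prodr_const ?card_ord // => i _; rewrite mxE.
Qed.

(** R has to be P p - X^(s+1) (X a + (X^2 + e) b).  Since p(0) <> 0, X^(s+1) is
    invertible modulo p, and [window_mod] provides a and b for which p divides
    R + X^(s+1) (X a + (X^2 + e) b); the quotient is P. *)
Lemma flexible_block m d delta e (M : 'M[F]_m) p :
  delta * delta = 1 -> \det M != 0 -> flexible delta e M ->
  p \is monic -> size p = d.+1 -> (1 < d)%N -> p`_0 != 0 ->
  (d = 2 -> p`_0 != e) ->
  flexible delta e (block_mx M 0 0 (sgn_mx d delta *m comp_mx d p)).
Proof.
move=> delta2 dM [w [W [phi [s [k [le_s flex]]]]]] mon_p sz_p d1 p0 pe.
have nz_delta : delta != 0.
  by apply: contraTneq (oner_neq0 F) => d0; rewrite -delta2 d0 mul0r eqxx.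
exists (w + 1)%N, (col_mx (row_mx W 0) (row_mx (0 : 'rV_m) (evec F d 0))).
exists (@ext_phi F m d), s.+1, (k + d.-1)%N; split; first by lia.
move=> R mR sR R0.
have nz_p : p != 0 by apply: monic_neq0.
have coX : coprimep 'X^(s.+1) p.
  by rewrite coprimep_expl // coprimep_sym coprimepX rootE horner_coef0.
have [v vE] := Bezout_eq1_coprimepP _ _ coX.
have [a [b [sa sb dvd_p]]] := window_mod (- R * v.1) mon_p sz_p d1 p0 pe.
(* v.1 is an inverse of X^(s+1) modulo p. *)
pose T := 'X^(s.+1) * ('X * a + ('X^2 + e%:P) * b).
have dvd_RT : p %| R + T.
  have -> : R + T = R * v.2 * p
      - 'X^(s.+1) * (- R * v.1 - ('X * a + ('X^2 + e%:P) * b)).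
    by rewrite -[R in LHS]mulr1 -vE /T; ring.
  by rewrite dvdp_subr ?dvdp_mull ?dvdpp.
have sL : (size ('X * a + ('X^2 + e%:P) * b)%R <= d.+1)%N.
  rewrite (leq_trans (size_polyD _ _)) // geq_max; apply/andP; split.
    by rewrite (leq_trans (size_polyMleq _ _)) // size_polyX; lia.
  apply: leq_trans (size_polyMleq _ _) _.
  by move: (size_X2D e) sb; move: (size _) (size _) => x y; lia.
have sT : (size T < size R)%N.
  rewrite sR ltnS /T; apply: leq_trans (size_polyMleq _ _) _; rewrite size_polyXn.
  by move: sL; move: (size _) => z; lia.
pose P := (R + T) %/ p.
have PE : P * p = R + T by rewrite divpK.
have mRT : R + T \is monic by rewrite monicE lead_coefDl // (monicP mR).
have mP : P \is monic by rewrite -(monicMr _ mon_p) PE.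
have sP : size P = m.+1.
  have := size_polyDl sT; rewrite -PE size_mul ?monic_neq0 // sz_p sR.
  by move: (size _) => z; lia.
have P0p0 : P`_0 * p`_0 = R`_0.
  by rewrite -coef0M PE coefD /T coefXnM addr0.
have P0 : P`_0 = (-1) ^+ m * delta ^+ k * \det M.
  apply: (mulIf p0); rewrite P0p0 R0 det_ublock det_sgn_comp 1?ltnW //.
  rewrite !exprD; have [e1 e2] : (-1) ^+ d * (-1) ^+ d = 1 :> F /\
    delta ^+ d.-1 * delta ^+ d.-1 = 1.
    by rewrite -!exprMn delta2 mulrNN mulr1 !expr1n.
  rewrite -[RHS]mulr1 -[X in _ = _ * X]e1 -[RHS]mulr1 -[X in _ = _ * X]e2.
  by move: (_ ^+ d) (_ ^+ m) (delta ^+ k) (delta ^+ _) => *; ring.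
have [A [g [cfg win1 win2]]] := flex P mP sP P0.
have [ca ca0 aE] := drop_poly_span mon_p sz_p sa.
have [cb cb0 bE] := drop_poly_span mon_p sz_p sb.
pose h j := ca j *: 'X^(s.+1) + cb j *: ('X^s * ('X^2 + e%:P)).
have h_size j : (size (h j) <= m)%N.
  apply: leq_trans (size_polyD _ _) _; rewrite geq_max; apply/andP; split.
    by apply: leq_trans (size_scale_leq _ _) _; rewrite size_polyXn ltnW.
  apply: leq_trans (size_scale_leq _ _) _.
  exact: leq_trans (size_window s e) le_s.
have h0 : h 0 = 0 by rewrite /h ca0 cb0 !scale0r addr0.
have h_sub j : (pact g A (h j) <= W *m M)%MS.
  by rewrite pactD !pactZ addmx_sub ?scalemx_sub.
have m0 : (0 < m)%N by exact: leq_trans le_s.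
have P0n : P`_0 != 0.
  by rewrite P0 !mulf_neq0 ?expf_neq0 // oppr_eq0 oner_neq0.
have hsum : \sum_(j < d) h j * drop_poly j.+1 p
    = 'X^s * ('X * a + ('X^2 + e%:P) * b).
  rewrite [X in 'X * X]aE [X in _ + _ * X]bE !mulr_sumr -big_split mulr_sumr.
  by apply: eq_bigr => j _; rewrite /h -!mul_polyC exprS /=; ring.
have := completion_ext 0 m0 d1 delta2 mP sP P0n mon_p sz_p cfg h_size h0 h_sub.
have := completion_ext_window p 0 m0 d1 mP sP P0n cfg h_size h0.
rewrite scale0r subr0 hsum.
have -> : P * p - 'X * ('X^s * ('X * a + ('X^2 + e%:P) * b)) = R.
  by rewrite PE /T exprS mulrA addrK.
move=> win cfg'.
exists (block_mx A (phi *m evec F d 1) (\matrix_(j < d) pact g A (h j)) (comp_mx d p)).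
exists (ext_gen A phi g P p (\matrix_(j < d) pact g A (h j))).
split=> //; first by rewrite exprS; apply: win => //; rewrite size_polyXn ltnW.
rewrite exprS -mulrA; apply: win => //.
exact: leq_trans (size_window s e) le_s.
Qed.
End Flexible.

(** * Pivots *)

Section FlexibleBase.
Variable F : fieldType.
Implicit Types p q R P : {poly F}.

Definition initial_rows n : 'M[F]_(n.-1, n) :=
  \matrix_(i < n.-1, j < n) (i == j :> nat)%:R.

Lemma initial_rows_comp n p : initial_rows n *m comp_mx n p =
  \matrix_(i < n.-1, j < n) (i.+1 == j :> nat)%:R.
Proof.
apply/row_matrixP => i; rewrite row_mul.
have lt_i : (i.+1 < n)%N by have := ltn_ord i; lia.
have -> : row i (initial_rows n) = evec F n i by apply/rowP => j; rewrite !mxE.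
by rewrite evec_comp //; apply/rowP => j; rewrite !mxE.
Qed.

(** The image of the first n-1 basis vectors under a companion matrix is spanned
    by the last n-1 ones. *)
Lemma sub_initial_rows k n p (A : 'M[F]_(k, n)) :
  (forall i (j : 'I_n), j = 0%N :> nat -> A i j = 0) ->
  (A <= initial_rows n *m comp_mx n p)%MS.
Proof.
move=> A0; rewrite initial_rows_comp; apply/submxP.
exists (\matrix_(i < k, l < n.-1) \sum_(j < n) (A i j *+ (l.+1 == j :> nat))).
apply/matrixP => i j; rewrite !mxE.
have [j0 | j_gt0] := posnP (j : nat).
  rewrite A0 // big1 // => l _; rewrite !mxE j0 mulr0 //.
have lt_j : (j.-1 < n.-1)%N by have := ltn_ord j; lia.
rewrite (bigD1 (Ordinal lt_j)) //= !mxE /= prednK // eqxx mulr1.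
rewrite [X in _ + X]big1 ?addr0 => [|l lj]; last first.
  rewrite !mxE (_ : (l.+1 == j :> nat) = false) ?mulr0 //.
  by apply: contra_neqF lj => /eqP lj; apply: val_inj => /=; rewrite -lj.
rewrite (bigD1 j) //= eqxx mulr1n big1 ?addr0 // => l lj.
by rewrite (_ : (j == l :> nat) = false) // eq_sym; apply: negPf.
Qed.

(** Two companion matrices agree on the first n-1 basis vectors, and the last row
    may be changed arbitrarily, except for its first entry. *)
Lemma completion_comp n delta p R : (0 < n)%N ->
  R \is monic -> size R = n.+1 -> R`_0 = delta * p`_0 ->
  completion delta (comp_mx n p) (initial_rows n) (evec F n n.-1)^T R
    (comp_mx n R) (evec F n 0).
Proof.
move=> n0 mR sR R0; split.
- split; last by rewrite !initial_rows_comp.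
  apply/matrixP => i j; rewrite !mxE big1 // => k _; rewrite !mxE.
  case: eqP => [<-|_]; last by rewrite mul0r.
  by rewrite gtn_eqF ?mulr0.
- apply: sub_initial_rows => i j j0; rewrite !mxE j0.
  by case: eqP => _; rewrite ?mulr0 ?subrr // mulrN opprK R0 addNr.
- move=> i lt_i; rewrite evec_comp_exp // add0n mxE.
  rewrite (bigD1 (Ordinal lt_i)) //= big1 ?addr0 => [|j ji]; rewrite !mxE /=.
    by rewrite eqxx mul1r -[in RHS](prednK n0) eqSS eq_sym.
  by rewrite eq_sym (_ : (j == i :> nat) = false) ?mul0r //; apply: negPf.
- have e := char_poly_comp mR sR.
  by rewrite -[R in pact _ _ R]e pact_char_poly.
Qed.

Lemma evec_sub_initial n p i : (0 < i)%N ->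
  (evec F n i <= initial_rows n *m comp_mx n p)%MS.
Proof.
by move=> i0; apply: sub_initial_rows => a j j0; rewrite mxE j0 gtn_eqF.
Qed.

Lemma comp_constant n k delta p : p \is monic -> size p = n.+1 ->
  (-1) ^+ n * delta ^+ k * \det (comp_mx n p) = delta ^+ k * p`_0.
Proof.
move=> mp sp; have e : (-1) ^+ n * (-1) ^+ n = 1 :> F.
  by rewrite -exprMn mulrNN mulr1 expr1n.
by rewrite det_comp // -[RHS]mul1r -[X in _ = X * _]e; ring.
Qed.

Lemma completable_comp n delta p : (0 < n)%N -> p \is monic -> size p = n.+1 ->
  completable delta (comp_mx n p).
Proof.
move=> n0 mp sp; exists 1%N => R mR sR; rewrite comp_constant // expr1 => R0.
do 5 eexists; exact: completion_comp.
Qed.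

(** The feedback vectors are the second and the third basis vector, whence the
    bound on n. *)
Lemma flexible_comp n delta p : (2 < n)%N -> p \is monic -> size p = n.+1 ->
  flexible delta 0 (comp_mx n p).
Proof.
move=> n2 mp sp; exists n.-1, (initial_rows n), (evec F n n.-1)^T, 0, 1%N.
split=> // R mR sR; rewrite comp_constant // expr1 => R0.
exists (comp_mx n R), (evec F n 0); split.
- by apply: completion_comp => //; lia.
- rewrite pact_X evec_comp ?evec_sub_initial //; lia.
- by rewrite mul1r addr0 pact_Xn evec_comp_exp ?evec_sub_initial.
Qed.

(** Let c = delta p1(0) and c' = p2(0).  The extension of the first block by the
    second one reaches the polynomials
    (X^2 + y X + c)(X^2 + y' X + c') - z X^2
    with y, y', z arbitrary.  The coefficients of X^3 and X give a linear system
    for y and y' with determinant c - c', and the coefficient of X^2 gives z.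
    The feedback polynomials are X X and X (X^2 + c); the latter comes
    from the link X (X^2 + y X + c), and it does not depend on y since the
    multiple y X X can be subtracted. *)
Lemma flexible_two_quadratics delta (p1 p2 : {poly F}) :
  delta * delta = 1 ->
  p1 \is monic -> size p1 = 3 -> p2 \is monic -> size p2 = 3 ->
  p1`_0 != 0 -> p2`_0 != 0 -> delta * p1`_0 != p2`_0 ->
  flexible delta (delta * p1`_0)
    (block_mx (comp_mx 2 p1) 0 0 (sgn_mx 2 delta *m comp_mx 2 p2)).
Proof.
move=> delta2 m1 s1 m2 s2 c1 c2 c12.
have nz_delta : delta != 0.
  by apply: contraTneq (oner_neq0 F) => d0; rewrite -delta2 d0 mul0r eqxx.
set c := delta * p1`_0 in c12 *.
have nz_c : c != 0 by rewrite mulf_neq0.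
do 3 eexists; exists 1%N, 0%N; split=> // R mR sR.
rewrite det_ublock det_sgn_comp // det_comp // => R0.
have {}R0 : R`_0 = c * p2`_0 by rewrite R0 /c; ring.
have dc : p2`_0 - c != 0 by rewrite subr_eq0 eq_sym.
pose y := (R`_1 - R`_3 * c) / (p2`_0 - c).
pose y2 := R`_3 - y.
pose P := 'X^2 + (y *: 'X + c%:P).
have sy : (size (y *: 'X + c%:P)%R < size ('X^2 : {poly F}))%N.
  rewrite size_polyXn ltnS (leq_trans (size_polyD _ _)) // geq_max.
  rewrite (leq_trans (size_scale_leq _ _)) ?size_polyX //.
  by rewrite (leq_trans (size_polyC_leq1 _)).
have mP : P \is monic by rewrite monicE lead_coefDl // lead_coefXn.
have sP : size P = 3 by rewrite size_polyDl // size_polyXn.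
have P0 : P`_0 = c by rewrite !(coefD, coefZ, coefX, coefXn, coefC) mulr0 !add0r.
have P0n : P`_0 != 0 by rewrite P0.
have cfgA : completion delta (comp_mx 2 p1) (initial_rows 2) (evec F 2 1)^T P
    (comp_mx 2 P) (evec F 2 0) by apply: completion_comp.
pose z := c + p2`_0 + y * y2 - R`_2.
pose h (j : nat) : {poly F} := if j == 1%N then z *: 'X else 0.
have h_size j : (size (h j) <= 2)%N.
  rewrite /h; case: ifP; rewrite ?size_poly0 //.
  by rewrite (leq_trans (size_scale_leq _ _)) ?size_polyX.
have h0 : h 0 = 0 by [].
have X_sub : (pact (evec F 2 0) (comp_mx 2 P) 'X <= initial_rows 2 *m comp_mx 2 p1)%MS.
  by rewrite pact_X evec_comp // evec_sub_initial.
have h_sub j : (pact (evec F 2 0) (comp_mx 2 P) (h j) <= initial_rows 2 *m comp_mx 2 p1)%MS.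
  by rewrite /h; case: ifP => _; rewrite ?pact0 ?sub0mx // pactZ scalemx_sub.
pose eta := p2`_1 - y2.
have [lt02 lt12] : (0 < 2)%N /\ (1 < 2)%N by [].
have cfg' := completion_ext eta lt02 lt12 delta2 mP sP P0n m2 s2 cfgA h_size h0 h_sub.
have win := completion_ext_window p2 eta lt02 lt12 mP sP P0n cfgA h_size h0.
have lnk := completion_ext_link p2 eta lt02 lt12 mP sP P0n cfgA h_size h0.
move: cfg' win lnk; set q := p2 - eta *: 'X.
have quad (f : {poly F}) : f \is monic -> size f = 3 ->
    f = 'X^2 + (f`_1 *: 'X + (f`_0)%:P).
  move=> mf sf; apply/polyP => -[|[|[|i]]]; rewrite !(coefD, coefZ, coefX, coefXn, coefC) /=.
  - by rewrite mulr0 !add0r.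
  - by rewrite mulr1 addr0 add0r.
  - by rewrite mulr0 !addr0 -(monicP mf) lead_coefE sf.
  - by rewrite mulr0 !addr0 nth_default // sf.
have qE : q = 'X^2 + (y2 *: 'X + (p2`_0)%:P).
  by rewrite /q {1}(quad _ m2 s2) /eta scalerBl; ring.
have dq : drop_poly 2 q = 1.
  apply/polyP => -[|i]; rewrite coef_drop_poly coef1 qE addn2;
    rewrite !(coefD, coefZ, coefX, coefXn, coefC) /=;
    by rewrite mulr0 !addr0.
rewrite big_ord_recl big_ord1 h0 mul0r add0r /= dq mulr1 /h /=.
have -> : P * q - 'X * (z *: 'X) = R.
  have RE : R = 'X^4 + (R`_3 *: 'X^3 + (R`_2 *: 'X^2 + (R`_1 *: 'X + (R`_0)%:P))).
    apply/polyP => -[|[|[|[|[|i]]]]]; rewrite !(coefD, coefZ, coefX, coefXn, coefC) /=;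
      rewrite ?mulr0 ?mulr1 ?add0r ?addr0 //.
      by rewrite -(monicP mR) lead_coefE sR.
    by rewrite nth_default // sR.
  have e1 : R`_1 = y * p2`_0 + y2 * c.
    have : y * (p2`_0 - c) = R`_1 - R`_3 * c by rewrite divfK.
    by move/(congr1 (+%R^~ (R`_3 * c))); rewrite /= subrK => <-; rewrite /y2; ring.
  have e3 : R`_3 = y + y2 by rewrite /y2 addrC subrK.
  have e2 : R`_2 = c + p2`_0 + y * y2 - z by rewrite /z; ring.
  rewrite RE e1 e2 e3 R0 qE /P -!mul_polyC !(polyCD, polyCN, polyCM); ring.
move=> cfg' win lnk.
do 2 eexists; split; first exact: cfg'.
- by apply: win => //; rewrite size_polyX.
have -> : 'X^1 * ('X^2 + c%:P) = 'X * P - y *: ('X * 'X) by rewrite /P -!mul_polyC; ring.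
rewrite pactB pactZ addmx_sub // -?scaleN1r ?scalemx_sub //.
by apply: win => //; rewrite size_polyX.
Qed.
End FlexibleBase.

(** * Cyclic products of two quadratic matrices *)

Section ThreeFactors.
Variable F : fieldType.

Definition quadratic_mx n (delta : F) (A : 'M[F]_n) : Prop :=
  (A - 1%:M) *m (A - delta%:M) = 0.

Lemma quadratic_unipotent2 n (A : 'M[F]_n) : quadratic_mx 1 A -> unipotent2 A.
Proof. by []. Qed.

Lemma quadratic_involution n (A : 'M[F]_n) : quadratic_mx (-1) A -> involution A.
Proof.
rewrite /quadratic_mx /involution raddfN /= opprK mulmxBl mul1mx mulmxDr mulmx1.
by rewrite opprD addrA addrK => /eqP; rewrite subr_eq0 => /eqP.
Qed.

Lemma quadratic_conj n delta (A P : 'M[F]_n) : P \in unitmx ->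
  quadratic_mx delta A -> quadratic_mx delta (invmx P *m A *m P).
Proof.
move=> Pu qA; rewrite /quadratic_mx.
have e (c : F) : invmx P *m A *m P - c%:M = invmx P *m (A - c%:M) *m P.
  rewrite mulmxBr mulmxBl; congr (_ - _).
  by rewrite mul_mx_scalar -scalemxAl mulVmx // scalemx1.
rewrite !e -!mulmxA (mulmxA P) mulmxV // mul1mx (mulmxA (A - _)) qA.
by rewrite mul0mx mulmx0.
Qed.

(** N = K M^-1 fixes W pointwise and N - delta maps everything to W, so that
    (N - delta)(N - 1) = 0.  The inverse T of N satisfies the same equation
    because delta^-1 = delta. *)
Lemma completion_factor n w delta (M : 'M[F]_n) (W : 'M[F]_(w, n)) phi R K g :
  delta * delta = 1 -> M \in unitmx -> completion delta M W phi R K g ->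
  exists2 T, quadratic_mx delta T & M = T *m K.
Proof.
move=> delta2 uM [[_ WK] /submxP[D KM] _ _].
pose N := K *m invmx M; have KE : K = N *m M by rewrite mulmxKV.
have WN : W *m N = W by rewrite mulmxA WK mulmxK.
have ND : N - delta%:M = D *m W.
  apply: (can_inj (mulmxK uM)); rewrite mulmxBl -KE mul_scalar_mx KM.
  by rewrite mulmxA.
have N2 : N *m N = (1 + delta) *: N - delta%:M.
  have : (N - delta%:M) *m (N - 1%:M) = 0.
    by rewrite ND mulmxBr mulmx1 -mulmxA WN subrr.
  rewrite mulmxBl !mulmxBr !mulmx1 !mul_scalar_mx.
  move/eqP; rewrite subr_eq0 subr_eq => /eqP ->.
  by rewrite scalerDl scale1r addrC addrA.
exists (delta *: ((1 + delta)%:M - N)).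
  have T1 : delta *: ((1 + delta)%:M - N) - 1%:M = delta *: (1%:M - N).
    rewrite !scalerBr !scale_scalar_mx mulrDr delta2 mulr1 raddfD /=.
    by rewrite addrAC addrK.
  have Td : delta *: ((1 + delta)%:M - N) - delta%:M = delta *: (delta%:M - N).
    rewrite !scalerBr !scale_scalar_mx mulrDr delta2 mulr1 raddfD /=.
    by rewrite [delta%:M + _]addrC addrAC addrK.
  rewrite /quadratic_mx T1 Td -scalemxAl -scalemxAr mulmxBl !mulmxBr N2.
  rewrite !mul1mx mul_mx_scalar scalerDl scale1r opprB.
  by rewrite [X in _ + X]addrAC addrK addrA subrK subrr !scaler0.
rewrite KE mulmxA -scalemxAl mulmxBl N2 mul_scalar_mx opprB addrC subrK.
by rewrite scale_scalar_mx delta2 mul1mx.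
Qed.

(** The i-th iterate of the first basis vector ends at position i. *)
Lemma hessenberg_cyclic n (A : 'M[F]_n) :
  (forall i j : 'I_n, (i.+1 < j)%N -> A i j = 0) ->
  (forall i j : 'I_n, i.+1 = j -> A i j != 0) ->
  krylov n (evec F n 0) A \in unitmx.
Proof.
move=> A0 A1; case: n => [|n] in A A0 A1 *; first by rewrite unitmxE det_mx00 unitr1.
have e0 : evec F n.+1 0 = \row_j (0%N == j)%:R by [].
have low : forall i, (i <= n)%N -> (forall j : 'I_n.+1, (i < j)%N ->
      (evec F n.+1 0 *m A ^+ i) 0 j = 0) /\
    (forall j : 'I_n.+1, i = j -> (evec F n.+1 0 *m A ^+ i) 0 j != 0).
  elim=> [|i IHi] le_i.
    split=> j ij; rewrite mulmx1 mxE; first by rewrite ltn_eqF.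
    by rewrite ij eqxx oner_neq0.
  have [IH0 IH1] := IHi (ltnW le_i).
  rewrite exprSr -[_ * A]/(_ *m A) mulmxA; move: (_ *m A ^+ i) IH0 IH1 => y y0 y1.
  split=> j ij; rewrite mxE.
    rewrite big1 // => k _; have [le_ki | lt_ik] := leqP k i.
      by rewrite A0 ?mulr0 // (leq_ltn_trans _ ij).
    by rewrite y0 // mul0r.
  have lt_i : (i < n.+1)%N by rewrite ltnW.
  rewrite (bigD1 (Ordinal lt_i)) //= big1 ?addr0 => [|k ki].
    by rewrite mulf_neq0 ?y1 ?A1.
  have [lt_ki | lt_ik | eq_ki] := ltngtP k i.
  - by rewrite A0 ?mulr0 // -ij ltnS.
  - by rewrite y0 // mul0r.
  - by case/eqP: ki; apply: val_inj.
have [low0 low1] := low n (leqnn n).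
rewrite -row_free_unit; apply: (@krylov_moment _ _ _ _ _ (evec F n.+1 n)^T
    ((evec F n.+1 0 *m A ^+ n) 0 ord_max)); first exact: low1.
move=> i lt_i; rewrite mxE.
have phiE (j : 'I_n.+1) : (evec F n.+1 n)^T j 0 = (j == ord_max)%:R.
  by rewrite !mxE eq_sym.
rewrite (bigD1 ord_max) //= phiE eqxx mulr1 big1 ?addr0 => [|j /negPf jn]; last first.
  by rewrite phiE jn mulr0.
rewrite eqSS; have [-> // | ne_in] := eqVneq i n.
have lt_in : (i < n)%N by rewrite ltn_neqAle ne_in.
by have [-> //] := low i (ltnW lt_in).
Qed.

(** On each pair i, f i of distinct indices this is the companion matrix of
    (X - 1)(X - e), where src tells which of the two indices comes first; the
    fixed points of f are eigenvectors. *)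
Definition paired_mx n (f : 'I_n -> 'I_n) (src : pred 'I_n) (s : 'I_n -> F)
    (e : F) : 'M[F]_n :=
  \matrix_(i < n) (if f i == i then s i *: evec F n i
    else if src i then evec F n (f i)
    else - e *: evec F n (f i) + (1 + e) *: evec F n i).

Lemma evec_paired n f src s e (i : 'I_n) : evec F n i *m paired_mx f src s e =
  if f i == i then s i *: evec F n i
  else if src i then evec F n (f i)
  else - e *: evec F n (f i) + (1 + e) *: evec F n i.
Proof. by rewrite evec_mulE rowK. Qed.

Lemma quadratic_paired n (f : 'I_n -> 'I_n) src s e :
  involutive f -> (forall i, f i != i -> src (f i) = ~~ src i) ->
  (forall i, (s i - 1) * (s i - e) = 0) ->
  quadratic_mx e (paired_mx f src s e).
Proof.
move=> fK fsrc se; apply/row_matrixP => i; rewrite -evec_mulE linear0 mulmxA.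
rewrite [evec F n i *m _]mulmxBr mulmx1 mulmxBr mul_mx_scalar !mulmxBl !evec_paired.
have [fi | fi] := eqVneq (f i) i.
  rewrite -scalemxAl !evec_paired fi eqxx; apply/rowP => j; rewrite !mxE.
  transitivity ((s i - 1) * (s i - e) * (i == j)%:R); first by ring.
  by rewrite se mul0r.
case: ifP => si.
  rewrite evec_paired fK eq_sym (negPf fi) fsrc // si /=.
  by rewrite scalerDl scale1r !scaleNr addrAC -addrA; apply/rowP => j; rewrite !mxE; ring.
rewrite mulmxDl -!scalemxAl !evec_paired fK eq_sym (negPf fi) fsrc // si /=.
by apply/rowP => j; rewrite !mxE; ring.
Qed.

(** The mirror i -> n-i of the indices 0, ..., n, followed by the mirror
    i -> n+1-i of the indices 1, ..., n, sends i to i+1. *)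
Definition mirror n : 'I_n.+1 -> 'I_n.+1 := @rev_ord n.+1.
Definition shifted_mirror n (i : 'I_n.+1) : 'I_n.+1 :=
  inord (if i == 0%N :> nat then 0 else n.+1 - i)%N.

Lemma val_shifted_mirror n (i : 'I_n.+1) : (0 < i)%N ->
  shifted_mirror i = (n.+1 - i)%N :> nat.
Proof. by move=> i0; rewrite /shifted_mirror gtn_eqF // inordK //; lia. Qed.

Lemma shifted_mirror0 n : shifted_mirror (0 : 'I_n.+1) = 0.
Proof. by apply: val_inj; rewrite /= inordK. Qed.

Lemma shifted_mirrorK n : involutive (@shifted_mirror n).
Proof.
move=> i; have [i0 | i_gt0] := posnP (i : nat).
  have -> : i = 0 by apply: val_inj.
  by rewrite !shifted_mirror0.
apply: ord_inj; have lt_i := ltn_ord i; have e := val_shifted_mirror i_gt0.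
by rewrite val_shifted_mirror e; lia.
Qed.

Definition reflection1 n (e : F) : 'M[F]_n.+1 :=
  paired_mx (@mirror n) (fun i => i < mirror i)%N (fun=> 1) e.
Definition reflection2 n (s e : F) : 'M[F]_n.+1 :=
  paired_mx (@shifted_mirror n) (fun i => shifted_mirror i < i)%N
    (fun i => if i == 0 then s else 1) e.

Lemma quadratic_reflection1 n e : quadratic_mx e (reflection1 n e).
Proof.
apply: quadratic_paired => [|i|i]; first exact: rev_ordK.
  by rewrite /mirror rev_ordK -leqNgt [RHS]leq_eqVlt val_eqE => /negPf->.
by rewrite subrr mul0r.
Qed.

Lemma quadratic_reflection2 n s e : (s - 1) * (s - e) = 0 ->
  quadratic_mx e (reflection2 n s e).
Proof.
move=> se; apply: quadratic_paired => [|i|i]; first exact: shifted_mirrorK.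
  by rewrite shifted_mirrorK -leqNgt [RHS]leq_eqVlt val_eqE eq_sym => /negPf->.
by case: ifP => _ //; rewrite subrr mul0r.
Qed.

(** As the composition of the two mirrors is the shift, the product has nonzero
    entries just above the diagonal and zeros further to the right.  The cases are:
    i smaller than, equal to, or larger than its mirror image. *)
Lemma cyclic_reflections n (e1 s e2 : F) : e1 != 0 -> e2 != 0 ->
  cyclic_mx (reflection1 n e1 *m reflection2 n s e2).
Proof.
move=> nz1 nz2; set B := _ *m _.
have mirE (i : 'I_n.+1) : mirror i = (n - i)%N :> nat by rewrite /= subSS.
have low (i j : 'I_n.+1) : (i < j)%N ->
    B i j = (if (i < mirror i)%N then 1 else if mirror i == i then - e2 else e1 * e2)
      *+ (i.+1 == j).
  move=> ij; have le_j := ltn_ord j.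
  have -> : B i j = (evec F n.+1 i *m B) 0 j by rewrite evec_mulE [RHS]mxE.
  rewrite mulmxA evec_paired.
  have [i_mid | i_nmid] := eqVneq (mirror i) i.
    have := mirE i; rewrite i_mid => iE; rewrite ltnn.
    have i_gt0 : (0 < i)%N by lia.
    have smE := val_shifted_mirror i_gt0.
    have nfix : (shifted_mirror i == i) = false by apply/eqP => e; move: smE; rewrite e; lia.
    have nsrc : (shifted_mirror i < i)%N = false by rewrite smE; lia.
    rewrite scale1r evec_paired nfix nsrc !mxE smE.
    have -> : (n.+1 - i = i.+1)%N by lia.
    by rewrite (ltn_eqF ij) mulr0 addr0 mulr_natr.
  case: ifP => [lt_i | ge_i].
    have m_gt0 : (0 < mirror i)%N by lia.
    have smE := val_shifted_mirror m_gt0.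
    have {}smE : shifted_mirror (mirror i) = i.+1 :> nat by rewrite smE mirE; lia.
    rewrite evec_paired smE; case: ifP => [/eqP fx | nfx].
      have -> : (mirror i == 0) = false by apply/eqP => m0; rewrite m0 in m_gt0.
      by rewrite scale1r -fx smE mxE.
    suff -> : (i.+1 < mirror i)%N by rewrite mxE.
    move: nfx; rewrite -(inj_eq (@ord_inj _)) smE; lia.
  have i_gt : (mirror i < i)%N by move: i_nmid; rewrite -(inj_eq (@ord_inj _)); lia.
  have i_gt0 : (0 < i)%N by lia.
  have smE := val_shifted_mirror i_gt0.
  have m_gt0 : (0 < mirror i)%N by have := mirE i; lia.
  have smE' : shifted_mirror (mirror i) = i.+1 :> nat.
    by rewrite val_shifted_mirror // mirE; lia.
  have nfix : (shifted_mirror (mirror i) == mirror i) = false.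
    by rewrite -(inj_eq (@ord_inj _)) smE'; lia.
  have nsrc : (shifted_mirror (mirror i) < mirror i)%N = false by rewrite smE'; lia.
  have e_i : (evec F n.+1 i *m reflection2 n s e2) 0 j = 0.
    rewrite evec_paired; case: ifP => [fx | nfx].
      by rewrite 2!mxE (ltn_eqF ij) mulr0.
    have -> : (shifted_mirror i < i)%N.
      by move: nfx; rewrite -(inj_eq (@ord_inj _)) smE; have := mirE i; lia.
    rewrite mxE (_ : (shifted_mirror i == j :> nat) = false) // smE.
    by have := mirE i; lia.
  rewrite mulmxDl -!scalemxAl mxE [X in _ + X]mxE e_i mulr0 addr0 mxE evec_paired nfix nsrc.
  rewrite !mxE smE' (_ : (mirror i == j :> nat) = false); last by lia.
  by rewrite mulr0 addr0 mulrA mulrNN mulr_natr.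
exists (evec F n.+1 0); apply: hessenberg_cyclic => i j ij.
  by rewrite low ?(ltnW ij) // (ltn_eqF ij).
rewrite low -?ij // eqxx mulr1n; case: ifP => _; first exact: oner_neq0.
by case: ifP => _; rewrite ?oppr_eq0 // mulf_neq0.
Qed.

Lemma det_reflection2 n s e :
  \det (reflection2 n s e) = s * \det (reflection2 n 1 e).
Proof.
pose D : 'rV[F]_n.+1 := \row_i if i == 0 then s else 1.
have -> : reflection2 n s e = diag_mx D *m reflection2 n 1 e.
  apply/matrixP => i j; rewrite mul_diag_mx !mxE.
  have [-> | i0] := eqVneq i 0; last by rewrite mul1r.
  by rewrite shifted_mirror0 eqxx scale1r !mxE.
rewrite det_mulmx det_diag big_ord_recl mxE eqxx big1 ?mulr1 // => i _.
by rewrite mxE.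
Qed.

(** Sylvester's identity: both sides are the determinant of the product of
    two block matrices, taken in either order. *)
Lemma det_1D_mul m n (A : 'M[F]_(m, n)) (B : 'M[F]_(n, m)) :
  \det (1%:M + A *m B) = \det (1%:M + B *m A).
Proof.
have e1 : block_mx (1%:M + A *m B) A 0 1%:M =
    block_mx 1%:M A (- B) 1%:M *m block_mx 1%:M 0 B 1%:M.
  by rewrite mulmx_block !(mulmx1, mul1mx, mulmx0, add0r) addNr.
have e2 : block_mx 1%:M A 0 (1%:M + B *m A) =
    block_mx 1%:M 0 B 1%:M *m block_mx 1%:M A (- B) 1%:M.
  by rewrite mulmx_block !(mulmx1, mul1mx, mul0mx, addr0) subrr addrC.
have := congr1 determinant e1; have := congr1 determinant e2.
by rewrite !det_mulmx !det_ublock !det1 mul1r mulr1 mulrC => -> ->.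
Qed.

(** If L = c r is a factorization of full rank and L L = 0, then r c = 0, so that
    det (1 + c r) = det (1 + r c) = 1. *)
Lemma det_unipotent2 n (A : 'M[F]_n) : quadratic_mx 1 A -> \det A = 1.
Proof.
rewrite /quadratic_mx; set L := A - 1%:M => LL.
have -> : A = 1%:M + L by rewrite addrC subrK.
have crL : col_base L *m row_base L = L := mulmx_base L.
have fr : row_free (row_base L) := row_base_free L.
have fc : row_full (col_base L) := col_base_full L.
move: (col_base L) (row_base L) crL fr fc => c r crL fr fc.
rewrite -crL det_1D_mul; suff -> : r *m c = 0 by rewrite addr0 det1.
apply: (row_full_inj fc); apply: (row_free_inj fr).
by rewrite mulmx0 mul0mx mulmxA crL -mulmxA crL.
Qed.

(** If e2 = -1, the sign s by which the second factor acts on the first basis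
    vector is free, and it adjusts the determinant. *)
Lemma two_quadratics n (e1 e2 r : F) : (0 < n)%N -> e1 = 1 \/ e1 = -1 ->
  (e2 = -1 /\ r * r = 1) \/ [/\ e1 = 1, e2 = 1 & r = (-1) ^+ n] ->
  exists A B : 'M[F]_n, [/\ quadratic_mx e1 A, quadratic_mx e2 B,
    cyclic_mx (A *m B) & (char_poly (A *m B))`_0 = r].
Proof.
case: n => // n _ e1E e2r.
have sqr_sign : (-1) ^+ n.+1 * (-1) ^+ n.+1 = 1 :> F.
  by rewrite -exprMn mulrNN mulr1 expr1n.
have nz1 : e1 != 0 by case: e1E => ->; rewrite ?oppr_eq0 oner_neq0.
have nz2 : e2 != 0 by case: e2r => [[-> _] | [_ -> _]]; rewrite ?oppr_eq0 oner_neq0.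
suff [s qs ds] : exists2 s, (s - 1) * (s - e2) = 0 &
    \det (reflection1 n e1 *m reflection2 n s e2) = (-1) ^+ n.+1 * r.
  exists (reflection1 n e1), (reflection2 n s e2); split.
  - exact: quadratic_reflection1.
  - exact: quadratic_reflection2.
  - exact: cyclic_reflections.
  - by rewrite char_poly_det ds mulrA sqr_sign mul1r.
case: e2r => [[-> rr] | [-> -> ->]]; last first.
  exists 1; first by rewrite subrr mul0r.
  have q2 : quadratic_mx 1 (reflection2 n 1 1).
    by apply: quadratic_reflection2; rewrite subrr mul0r.
  have q1 := quadratic_reflection1 n 1.
  by rewrite det_mulmx (det_unipotent2 q2) (det_unipotent2 q1) mulr1 sqr_sign.
have sqr_det (A : 'M[F]_n.+1) : quadratic_mx (-1) A -> \det A * \det A = 1.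
  by move/quadratic_involution => AA; rewrite -det_mulmx AA det1.
pose D := \det (reflection1 n e1) * \det (reflection2 n 1 (-1)).
have DD : D * D = 1.
  have q2 : quadratic_mx (-1) (reflection2 n 1 (-1)).
    by apply: quadratic_reflection2; rewrite subrr mul0r.
  rewrite /D mulrACA (sqr_det _ q2) mulr1.
  have := quadratic_reflection1 n e1; case: e1E => [-> q | -> /sqr_det //].
  by rewrite det_unipotent2 ?mulr1.
pose s := (-1) ^+ n.+1 * r * D.
have ss : s * s = 1 by rewrite /s mulrACA DD mulr1 mulrACA sqr_sign rr mulr1.
exists s; first by rewrite opprK -subr_sqr expr1n expr2 ss subrr.
have -> : \det (reflection1 n e1 *m reflection2 n s (-1)) = s * D.
  by rewrite det_mulmx det_reflection2 mulrCA.
by rewrite /s -[LHS]mulrA DD mulr1.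
Qed.

Lemma three_quadratics n (delta e1 e2 : F) (M : 'M[F]_n) : (0 < n)%N ->
  completable delta M -> M \in unitmx -> delta * delta = 1 -> e1 = 1 \/ e1 = -1 ->
  (e2 = -1 /\ \det M * \det M = 1) \/ [/\ delta = 1, e1 = 1, e2 = 1 & \det M = 1] ->
  exists A B C : 'M[F]_n, [/\ quadratic_mx delta A, quadratic_mx e1 B,
    quadratic_mx e2 C & M = A *m B *m C].
Proof.
move=> n0 [k compl] uM delta2 e1E cond.
pose r := (-1) ^+ n * delta ^+ k * \det M.
have [|B [C [qB qC cBC rBC]]] := @two_quadratics n e1 e2 r n0 e1E.
  case: cond => [[-> dd] | [d1 -> -> dM]]; [left | right]; split=> //.
    rewrite /r mulrACA dd mulr1 mulrACA -!exprMn delta2 mulrNN mulr1.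
    by rewrite !expr1n mulr1.
  by rewrite /r d1 dM expr1n !mulr1.
have := compl _ (char_poly_monic _) (size_char_poly _) rBC.
case=> w [W [phi [K [g cfg]]]]; have [T qT MT] := completion_factor delta2 uM cfg.
case: cfg => _ _ mom gR.
have uK : krylov n g K \in unitmx.
  by rewrite -row_free_unit; apply: (@krylov_moment _ _ _ _ _ phi 1) => //; exact: oner_neq0.
have cK := cyclic_char_poly uK (char_poly_monic _) (size_char_poly _) gR.
have /similarP[P uP PK] : similar_mx K (B *m C).
  by apply: cyclic_similar => //; exists g.
exists T, (invmx P *m B *m P), (invmx P *m C *m P); split=> //.
- exact: quadratic_conj.
- exact: quadratic_conj.
rewrite MT -!mulmxA; congr (_ *m _); rewrite (mulmxA P) mulmxV // mul1mx.
by rewrite (mulmxA B) -PK mulKmx.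
Qed.
End ThreeFactors.

(** * Splitting off cyclic blocks *)

Section CyclicDecomposition.
Variable F : fieldType.

Lemma similar_free_full m n (A : 'M[F]_m) (B : 'M[F]_n) (P : 'M[F]_(n, m)) :
  row_free P -> row_full P -> P *m A = B *m P -> similar_mx A B.
Proof.
move=> /row_freeP[Q PQ] /row_fullP[Q' Q'P] PA; exists P, Q; split=> //.
suff -> : Q = Q' by [].
by rewrite -[Q]mul1mx -Q'P -mulmxA PQ mulmx1.
Qed.

Lemma tr_exp n (M : 'M[F]_n) i : (M^T ^+ i)^T = M ^+ i.
Proof.
elim: i => [|i IHi]; first exact: trmx1.
by rewrite exprS exprSr [LHS]trmx_mul trmxK IHi.
Qed.

Lemma pact_tr n (u : 'rV[F]_n) (M : 'M[F]_n) (phi : 'cV[F]_n) h :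
  pact u M h *m phi = u *m (pact phi^T M^T h)^T.
Proof.
rewrite mulmx_suml linear_sum mulmx_sumr; apply: eq_bigr => i _ /=.
by rewrite linearZ /= trmx_mul trmxK tr_exp -scalemxAl -scalemxAr mulmxA.
Qed.

Lemma krylov_free_functional d n (v : 'rV[F]_n) (M : 'M[F]_n) :
  (0 < d)%N -> row_free (krylov d v M) ->
  exists phi : 'cV[F]_n,
    forall i, (i < d)%N -> (v *m M ^+ i *m phi) 0 0 = 1 *+ (i.+1 == d).
Proof.
case: d => // d _ /row_freeP[B KB]; exists (col ord_max B) => i lt_i.
have -> : v *m M ^+ i = row (Ordinal lt_i) (krylov d.+1 v M) by rewrite rowK.
rewrite -row_mul -[B]mulmx1.
have -> : (row (Ordinal lt_i) (krylov d.+1 v M *m col ord_max (B *m 1%:M))) 0 0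
    = (krylov d.+1 v M *m B) (Ordinal lt_i) ord_max.
  by rewrite mulmx1 !mxE; apply: eq_bigr => j _; rewrite !mxE.
by rewrite KB mxE -val_eqE eqSS.
Qed.

(** The matrix of the values of phi on v M^(i+j) is triangular with respect to
    the antidiagonal. *)
Lemma krylov_tr_free d n (v : 'rV[F]_n) (M : 'M[F]_n) (phi : 'cV[F]_n) :
  (forall i, (i < d)%N -> (v *m M ^+ i *m phi) 0 0 = 1 *+ (i.+1 == d)) ->
  row_free (krylov d phi^T M^T).
Proof.
move=> mom; apply/krylov_freeP => h le_h h0; apply/eqP; apply: contraT => nz_h.
have := pact_moment_shift (oner_neq0 F) nz_h mom le_h.
by rewrite mulrC pactM pact_tr h0 trmx0 mulmx0 mxE eqxx.
Qed.

(** The length is bounded by n; a longest sequence exists by the law of excluded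
    middle. *)
Lemma longest_krylov n (M : 'M[F]_n) : (0 < n)%N ->
  exists d, [/\ (0 < d)%N, exists v, row_free (krylov d v M)
    & forall v, ~~ row_free (krylov d.+1 v M)].
Proof.
move=> n0; apply: NNPP => no_max.
have free_all d : exists v, row_free (krylov d.+1 v M).
  elim: d => [|d [v fv]].
    case: n n0 M no_max => // n _ M _; exists (evec F n.+1 0).
    rewrite -kermx_eq0; apply/rowV0P => u /sub_kermxP uK; apply/rowP => j.
    move: uK => /rowP/(_ 0); rewrite !mxE big_ord1 mxE mulmx1 mxE mulr1 => u0.
    by rewrite ord1 u0.
  apply: NNPP => none; apply: no_max; exists d.+1; split=> //; first by exists v.
  by move=> w; apply/negP => fw; apply: none; exists w.
have [v] := free_all n; rewrite /row_free => /eqP rk.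
by have := rank_leq_col (krylov n.+1 v M); rewrite rk ltnn.
Qed.

Lemma krylov_annihilator d n (v : 'rV[F]_n) (M : 'M[F]_n) :
  row_free (krylov d v M) -> ~~ row_free (krylov d.+1 v M) ->
  exists p : {poly F}, [/\ p \is monic, size p = d.+1 & pact v M p = 0].
Proof.
move=> /krylov_freeP inj /krylov_freeP notinj.
have [h [le_h h0 nz_h]] : exists h : {poly F},
    [/\ (size h <= d.+1)%N, pact v M h = 0 & h != 0].
  apply: NNPP => none; apply: notinj => h le_h h0; apply/eqP.
  by apply: contraT => nz_h; case: none; exists h.
have sz_h : size h = d.+1.
  apply/eqP; rewrite eqn_leq le_h ltnNge; apply: contraNN nz_h => le_hd.
  by rewrite (inj h).
have nz_l : lead_coef h != 0 by rewrite lead_coef_eq0.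
exists ((lead_coef h)^-1 *: h); split.
- by rewrite monicE lead_coefZ mulVf.
- by rewrite size_scale ?invr_eq0.
- by rewrite pactZ h0 scaler0.
Qed.

(** By [krylov_tr_free], applied to M and to its transpose, Krylov sequences of
    vectors and of functionals have the same maximal length d.  Let v and phi be
    as in [krylov_free_functional] for a sequence of length d.  The vectors
    v M^i span an invariant space, and so do the functionals M^j phi; the common
    kernel U of the latter is invariant, and it is a complement because the
    matrix of the values of the M^j phi at the v M^i is invertible.  For x in U,
    the sequence of v + x is not longer than d, so some nonzero polynomial of
    degree at most d kills v and x; it is a multiple of the polynomial of v. *)
Lemma cyclic_split n (M : 'M[F]_n) : (0 < n)%N ->
  exists d m (C : 'M[F]_d) (N : 'M[F]_m),
    [/\ (0 < d)%N, similar_mx M (block_mx C 0 0 N), cyclic_mx C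
      & forall x, pact x N (char_poly C) = 0].
Proof.
move=> n0; have [d [d0 [v fv] maxd]] := longest_krylov M n0.
have [phi mom] := krylov_free_functional d0 fv.
have fphi := krylov_tr_free mom.
have maxphi : ~~ row_free (krylov d.+1 phi^T M^T).
  apply/negP => /(krylov_free_functional (ltn0Sn d))[psi].
  by move/krylov_tr_free; rewrite trmxK; apply/negP/maxd.
have [p [mp sp p0]] := krylov_annihilator fv (maxd v).
have [q [mq sq q0]] := krylov_annihilator fphi maxphi.
set K := krylov d v M in fv; set Kt := krylov d phi^T M^T in fphi.
have KM : K *m M = comp_mx d p *m K := krylov_comp mp sp p0.
have KtM : M *m Kt^T = Kt^T *m (comp_mx d q)^T.
  by rewrite -[M in LHS]trmxK -!trmx_mul (krylov_comp mq sq q0).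
have H_free (y : 'rV[F]_d) : y *m K *m Kt^T = 0 -> y = 0.
  move=> yH; rewrite -[y]rVpolyK; set h := rVpoly y.
  have le_h : (size h <= d)%N by apply: size_poly.
  have [-> | nz_h] := eqVneq h 0; first by rewrite linear0.
  have := pact_moment_shift (oner_neq0 F) nz_h mom le_h.
  have lt_j : (d - size h < d)%N.
    by rewrite ltn_subrL d0 size_poly_gt0 nz_h.
  rewrite pactM (pact_krylov _ _ le_h) -/K rVpolyK pact_Xn -mulmxA.
  have -> : M ^+ (d - size h) *m phi = col (Ordinal lt_j) Kt^T.
    by rewrite -tr_row rowK trmx_mul trmxK tr_exp.
  by rewrite colE mulmxA yH mul0mx mxE eqxx.
have rKt : \rank Kt^T = d.
  by rewrite mxrank_tr; move: fphi; rewrite /row_free => /eqP.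
pose U := row_base (kermx Kt^T).
have UKt : U *m Kt^T = 0.
  by apply/sub_kermxP; rewrite eq_row_base.
have [N UM] : exists N, U *m M = N *m U.
  apply/submxP; rewrite (eq_row_base (kermx Kt^T)); apply/sub_kermxP.
  by rewrite -mulmxA KtM mulmxA UKt mul0mx.
pose P := col_mx K U.
have dim : (d + \rank (kermx Kt^T))%N = n.
  by rewrite mxrank_ker rKt subnKC // -rKt rank_leq_row.
have freeP : row_free P.
  rewrite -kermx_eq0; apply/rowV0P => u /sub_kermxP.
  rewrite -[u]hsubmxK mul_row_col => yz0.
  have y0 : lsubmx u = 0.
    apply: H_free; move/(congr1 (mulmxr Kt^T)): yz0.
    by rewrite /= mulmxDl mul0mx -(mulmxA _ U) UKt mulmx0 addr0.
  move: yz0; rewrite y0 mul0mx add0r => z0.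
  suff -> : rsubmx u = 0 by rewrite row_mx0.
  by apply: (row_free_inj (row_base_free (kermx Kt^T))); rewrite mul0mx.
have fullP : row_full P by move: freeP; rewrite /row_free /row_full => /eqP ->; rewrite dim.
have simP : similar_mx M (block_mx (comp_mx d p) 0 0 N).
  apply: (similar_free_full freeP fullP).
  by rewrite mul_col_mx mul_block_col !mul0mx addr0 add0r KM UM.
exists d, (\rank (kermx Kt^T)), (comp_mx d p), N; split=> //.
  exact: cyclic_comp.
move=> x; rewrite char_poly_comp //.
have /krylov_freeP notfree := maxd (row_mx (evec F d 0) x *m P).
have PM : block_mx (comp_mx d p) 0 0 N *m P = P *m M.
  by symmetry; rewrite mul_col_mx mul_block_col !mul0mx addr0 add0r KM UM.
apply: NNPP => xp; apply: notfree => h le_h h0; apply/eqP.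
apply: contraT => nz_h; case: xp.
move: h0; rewrite -(pact_morph _ _ PM) -(mul0mx _ P) => /(row_free_inj freeP).
rewrite pact_block -row_mx0 => /eq_row_mx[h1 h2].
have uK : krylov d (evec F d 0) (comp_mx d p) \in unitmx.
  by rewrite krylov_evec_comp unitmx1.
have pe0 : pact (evec F d 0) (comp_mx d p) p = 0.
  by rewrite -{2}(char_poly_comp mp sp) pact_char_poly.
have dv := pact_cyclic_dvd uK mp sp pe0 h1.
apply: pact_dvd h2 _; suff /andP[_ ->] : p %= h by [].
by rewrite -dvdp_size_eqp // eqn_leq sp le_h -sp dvdp_leq.
Qed.

Inductive block_sum (P : forall d, 'M[F]_d -> Prop) :
    forall n, 'M[F]_n -> Prop :=
| block_sum_nil (M : 'M[F]_0) : block_sum P M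
| block_sum_cons d n m (C : 'M[F]_d) (N : 'M[F]_n) (M : 'M[F]_m) :
    P d C -> block_sum P N -> similar_mx M (block_mx C 0 0 N) -> block_sum P M.

Definition large_cyclic d (C : 'M[F]_d) : Prop := cyclic_mx C /\ (1 < d)%N.

(** Jordan cells of size 1, without a Jordan decomposition of the remainder N1. *)
Definition one_cell n (a : F) (N : 'M[F]_n) : Prop :=
  exists m (N1 : 'M[F]_m), similar_mx N (block_mx (a%:M : 'M_1) 0 0 N1).

Definition two_cells n (a : F) (N : 'M[F]_n) : Prop :=
  exists m (N1 : 'M[F]_m),
    similar_mx N (block_mx (a%:M : 'M_1) 0 0 (block_mx (a%:M : 'M_1) 0 0 N1)).

Lemma similar_blockl m n m' (A : 'M[F]_m) (A' : 'M[F]_m') (B : 'M[F]_n) :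
  similar_mx A A' -> similar_mx (block_mx A 0 0 B) (block_mx A' 0 0 B).
Proof. by move=> AA; apply: similar_block AA (similar_refl B). Qed.

Lemma similar_blockr m n n' (A : 'M[F]_m) (B : 'M[F]_n) (B' : 'M[F]_n') :
  similar_mx B B' -> similar_mx (block_mx A 0 0 B) (block_mx A 0 0 B').
Proof. exact: similar_block (similar_refl A). Qed.

Lemma similar_blockCA m n p (A : 'M[F]_m) (B : 'M[F]_n) (C : 'M[F]_p) :
  similar_mx (block_mx A 0 0 (block_mx B 0 0 C))
             (block_mx B 0 0 (block_mx A 0 0 C)).
Proof.
apply: similar_trans (similar_blockA A B C) _.
apply: similar_trans (similar_blockl _ (similar_blockC A B)) _.
exact/similar_sym/similar_blockA.
Qed.

Lemma similar_one_cell m n a (A : 'M[F]_m) (B : 'M[F]_n) :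
  similar_mx A B -> one_cell a B -> one_cell a A.
Proof. by move=> AB [k [N BN]]; exists k, N; apply: similar_trans AB BN. Qed.

Lemma similar_two_cells m n a (A : 'M[F]_m) (B : 'M[F]_n) :
  similar_mx A B -> two_cells a B -> two_cells a A.
Proof. by move=> AB [k [N BN]]; exists k, N; apply: similar_trans AB BN. Qed.

Lemma one_cell_left m n a (A : 'M[F]_m) (B : 'M[F]_n) :
  one_cell a A -> one_cell a (block_mx A 0 0 B).
Proof.
case=> k [N AN]; exists (k + n)%N, (block_mx N 0 0 B).
apply: similar_trans (similar_blockl B AN) _.
exact/similar_sym/similar_blockA.
Qed.

Lemma one_cell_right m n a (A : 'M[F]_m) (B : 'M[F]_n) :
  one_cell a B -> one_cell a (block_mx A 0 0 B).
Proof.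
by move=> cB; apply: similar_one_cell (similar_blockC A B) (one_cell_left _ cB).
Qed.

Lemma two_cells_block m n a (A : 'M[F]_m) (B : 'M[F]_n) :
  one_cell a A -> one_cell a B -> two_cells a (block_mx A 0 0 B).
Proof.
move=> [k [N AN]] cB; have [l [N' BN]] := one_cell_right N cB.
exists l, N'; apply: similar_trans (similar_blockl B AN) _.
apply: similar_trans (similar_sym (similar_blockA _ _ _)) _.
exact: similar_blockr.
Qed.

Lemma two_cells_right m n a (A : 'M[F]_m) (B : 'M[F]_n) :
  two_cells a B -> two_cells a (block_mx A 0 0 B).
Proof.
case=> k [N BN]; exists (m + k)%N, (block_mx A 0 0 N).
apply: similar_trans (similar_blockr A BN) _.
apply: similar_trans (similar_blockCA _ _ _) _.
exact/similar_blockr/similar_blockCA.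
Qed.

(** Once a block of size 1 has been split off, its characteristic polynomial
    X - a kills the remainder, which is then the scalar matrix a. *)
Lemma similar_large_tail n (N : 'M[F]_n) :
  [\/ block_sum large_cyclic N,
      exists a m (N1 : 'M[F]_m), similar_mx N (block_mx (a%:M : 'M_1) 0 0 N1) /\
        block_sum large_cyclic N1
    | exists a, two_cells a N].
Proof.
have [k le_k] := ubnP n; elim: k n N le_k => // k IHk n N; rewrite ltnS => le_k.
have [n0 | n_gt0] := posnP n.
  by apply: Or31; move: N; rewrite n0 => N; apply: block_sum_nil.
have [d [m [C [N0 [d0 simN cycC killN]]]]] := cyclic_split N n_gt0.
have szn := similar_size simN.
have [d1 | d_gt1] := eqVneq d 1%N.
  subst d; have CE : C = (C 0 0)%:M by rewrite [LHS]mx11_scalar.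
  have charC : char_poly C = 'X - (C 0 0)%:P.
    by rewrite char_poly_trig ?big_ord1 //; apply/is_trig_mxP => i j; rewrite !ord1.
  have N0E : N0 = (C 0 0)%:M.
    apply/row_matrixP => i; rewrite -!evec_mulE mul_mx_scalar; apply/eqP.
    by rewrite -subr_eq0 -(killN (evec F m i)) charC pactB pact_X pactC.
  case: m N0 N0E simN {killN szn} => [|m] N0 N0E simN.
    apply: Or32; exists (C 0 0), 0%N, N0; rewrite -CE; split=> //.
    exact: block_sum_nil.
  apply: Or33; exists (C 0 0), m, (C 0 0)%:M.
  by move: simN; rewrite N0E {1}CE (@scalar_mx_block _ 1 m).
have lt_mk : (m < k)%N by lia.
have [sN0 | [a [l [N1 [simN0 sN1]]]] | [a two]] := IHk m N0 lt_mk.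
- by apply: Or31; apply: block_sum_cons sN0 simN; split=> //; lia.
- apply: Or32; exists a, (d + l)%N, (block_mx C 0 0 N1); split.
    apply: similar_trans simN _; apply: similar_trans (similar_blockr C simN0) _.
    exact: similar_blockCA.
  apply: block_sum_cons sN1 (similar_refl _); split=> //; lia.
- by apply: Or33; exists a; apply: similar_two_cells simN (two_cells_right C two).
Qed.
End CyclicDecomposition.

(** * Jordan cells *)

Section Jordan.
Variable F : fieldType.

Lemma char_poly_scalar1 (a : F) : char_poly (a%:M : 'M_1) = 'X - a%:P.
Proof.
by rewrite char_poly_trig ?big_ord1 ?mxE ?eqxx // scalar_mx_is_trig.
Qed.

Lemma jordan_cell1 (a : F) : jordan_cell a 1 = a%:M.
Proof. by apply/matrixP => i j; rewrite !mxE !ord1 eqxx. Qed.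

Lemma char_poly_jordan_cell (a : F) k :
  char_poly (jordan_cell a k) = ('X - a%:P) ^+ k.
Proof.
rewrite /char_poly -det_tr det_trig; last first.
  apply/is_trig_mxP => i j ij; rewrite !mxE -val_eqE /= gtn_eqF //.
  by rewrite (_ : (i == j.+1 :> nat) = false) ?subrr ?subr0 // ltn_eqF // ltnW.
rewrite (eq_bigr (fun=> 'X - a%:P)) ?prodr_const ?card_ord // => i _.
by rewrite !mxE eqxx.
Qed.

Lemma cyclic_jordan_cell (a : F) k : cyclic_mx (jordan_cell a k).
Proof.
exists (evec F k 0); apply: hessenberg_cyclic => i j ij; rewrite mxE -val_eqE /=.
  by rewrite ltn_eqF ?gtn_eqF // ltnW.
by rewrite -ij eqxx ltn_eqF // oner_neq0.
Qed.

Lemma similar_jordan_sizes n (M : 'M[F]_n) a m (p : 'I_m -> nat) r (N : 'M[F]_r) :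
  (forall i, (0 < p i)%N) -> ~~ eigenvalue N a ->
  similar_mx M (block_mx (\mxdiag_(i < m) jordan_cell a (p i)) 0 0 N) ->
  jordan_sizes M a p.
Proof.
move=> p0 nN [P [Q [PQ QP PM]]]; split=> //; exists r, N, P; split=> //.
  by apply/row_freeP; exists Q.
by apply/row_fullP; exists Q.
Qed.

Lemma jordan_sizes_similar n (M : 'M[F]_n) a m (p : 'I_m -> nat) :
  jordan_sizes M a p -> (forall i, (0 < p i)%N) /\
  exists r (N : 'M[F]_r), ~~ eigenvalue N a /\
  similar_mx M (block_mx (\mxdiag_(i < m) jordan_cell a (p i)) 0 0 N).
Proof.
case=> p0 [r [N [P [nN freeP fullP PM]]]]; split=> //; exists r, N; split=> //.
exact: similar_free_full PM.
Qed.

(** Jordan decompositions whose sizes are listed in a sequence, so that adding a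
    cell is consing. *)
Definition jordan_seq n (M : 'M[F]_n) a (s : seq nat) : Prop :=
  jordan_sizes M a (fun i : 'I_(size s) => nth 0%N s i).

Lemma jordan_seq_nil n (M : 'M[F]_n) a : ~~ eigenvalue M a -> jordan_seq M a [::].
Proof.
move=> nM; apply: similar_jordan_sizes nM _ => [|]; first by case.
have : (\sum_(i < size (Nil nat)) nth 0 [::] i)%N = 0%N by apply: big_ord0.
move: (\mxdiag_(i < _) _) => /=; move: (\sum_(_ < _) _)%N => s D s0; subst s.
apply: similar_sym; apply: similar_trans (similar_blockC _ _) _.
exact: similar_block0.
Qed.

Lemma jordan_seq_cons n r (M : 'M[F]_n) (N : 'M[F]_r) a k s : (0 < k)%N ->
  similar_mx M (block_mx (jordan_cell a k) 0 0 N) -> jordan_seq N a s ->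
  jordan_seq M a (k :: s).
Proof.
move=> k0 simM /jordan_sizes_similar[p0 [r' [N' [nN' simN]]]].
apply: (similar_jordan_sizes _ nN') => [i|].
  case: (unliftP ord0 i) => [j -> | -> //]; exact: p0.
apply: similar_trans simM _; apply: similar_trans (similar_blockr _ simN) _.
apply: similar_trans (similar_blockA _ _ _) _; apply: similar_blockl.
by rewrite mxdiag_recl; apply: similar_cast.
Qed.

Lemma jordan_seq_rest n r d (M : 'M[F]_n) (N : 'M[F]_r) (C : 'M[F]_d) a s :
  ~~ eigenvalue C a -> similar_mx M (block_mx C 0 0 N) -> jordan_seq N a s ->
  jordan_seq M a s.
Proof.
move=> nC simM /jordan_sizes_similar[p0 [r' [N' [nN' simN]]]].
apply: (similar_jordan_sizes (N := block_mx C 0 0 N') p0).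
  rewrite eigenvalue_root_char char_poly_block rootM negb_or.
  by rewrite -!eigenvalue_root_char nC.
apply: similar_trans simM _; apply: similar_trans (similar_blockr _ simN) _.
exact: similar_blockCA.
Qed.

Lemma cyclic_coprime_split d k l (C : 'M[F]_d) (A : 'M[F]_k) (B : 'M[F]_l) :
  cyclic_mx C -> cyclic_mx A -> cyclic_mx B ->
  coprimep (char_poly A) (char_poly B) ->
  char_poly C = char_poly A * char_poly B -> similar_mx C (block_mx A 0 0 B).
Proof.
move=> cC cA cB co eC; apply: cyclic_similar cC (cyclic_block cA cB co) _.
by rewrite char_poly_block.
Qed.

Lemma root_power_factor (p : {poly F}) a : p \is monic ->
  exists k q, [/\ q \is monic, ~~ root q a & p = ('X - a%:P) ^+ k * q].
Proof.
move=> mp; have [k [q nq pE]] := multiplicity_XsubC p a.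
rewrite monic_neq0 //= in nq; exists k, q; split=> //; last by rewrite mulrC.
by rewrite -(monicMr _ (monic_exp k (monicXsubC a))) -pE.
Qed.

(** Split a cyclic block (X - a)^l q off, with q(a) <> 0: it is the sum of a
    cell of size l and of the companion matrix of q. *)
Lemma jordan_seq_exists n (M : 'M[F]_n) a : exists s, jordan_seq M a s.
Proof.
have [k le_k] := ubnP n; elim: k n M le_k => // k IHk n M; rewrite ltnS => le_k.
have [n0 | n_gt0] := posnP n.
  exists [::]; apply: jordan_seq_nil; rewrite eigenvalue_root_char.
  move: M; rewrite n0 => M; have := size_char_poly M.
  move=> /eqP/size_poly1P[c nz_c ->]; by rewrite rootC.
have [d [m [C [N [d0 simM cycC _]]]]] := cyclic_split M n_gt0.
have szn := similar_size simM; have lt_m : (m < k)%N by lia.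
have [s sN] := IHk m N lt_m.
have [l [q [mq nq charC]]] := root_power_factor a (char_poly_monic C).
have [l0 | l0] := posnP l.
  exists s; apply: jordan_seq_rest simM sN.
  by rewrite eigenvalue_root_char charC l0 expr0 mul1r.
have sq : size q = (size q).-1.+1 by rewrite prednK // size_poly_gt0 monic_neq0.
have charq := char_poly_comp mq sq.
have simC : similar_mx C (block_mx (jordan_cell a l) 0 0 (comp_mx (size q).-1 q)).
  apply: cyclic_coprime_split => //.
  - exact: cyclic_jordan_cell.
  - exact: cyclic_comp.
  - by rewrite char_poly_jordan_cell charq coprimep_expl // coprimep_sym coprimep_XsubC.
  - by rewrite char_poly_jordan_cell charq.
exists (l :: s).
apply: (@jordan_seq_cons _ _ _ (block_mx (comp_mx (size q).-1 q) 0 0 N)) => //.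
  apply: similar_trans simM _; apply: similar_trans (similar_blockl _ simC) _.
  exact/similar_sym/similar_blockA.
apply: jordan_seq_rest (similar_refl _) sN.
by rewrite eigenvalue_root_char charq.
Qed.

(** A splitting into two cells of size 1 and a remainder extends to a Jordan
    decomposition, by decomposing the remainder. *)
Lemma no_two_cells n (M : 'M[F]_n) a :
  (eigenvalue M a -> at_most_one_jordan_cell_of_size1 M a) -> ~ two_cells a M.
Proof.
move=> at_most1 [m [N simM]].
have [s sN] := jordan_seq_exists N a.
have s1 : jordan_seq (block_mx (a%:M : 'M_1) 0 0 N) a (1%N :: s).
  by apply: jordan_seq_cons sN => //; rewrite jordan_cell1; apply: similar_refl.
have s2 : jordan_seq M a [:: 1, 1 & s]%N.
  by apply: jordan_seq_cons s1 => //; rewrite jordan_cell1.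
have ev : eigenvalue M a.
  rewrite eigenvalue_root_char (similar_char_poly simM) char_poly_block.
  by rewrite char_poly_scalar1 rootM root_XsubC eqxx.
have := at_most1 ev _ _ s2; apply/negP; rewrite -ltnNge.
pose i0 : 'I_(size [:: 1, 1 & s]%N) := ord0.
pose i1 : 'I_(size [:: 1, 1 & s]%N) := lift ord0 ord0.
apply: (@leq_trans #|[set i0; i1]|); first by rewrite cards2.
by apply/subset_leq_card/subsetP => i; rewrite !inE => /orP[] /eqP->.
Qed.

Lemma one_cell_simple_root d (C : 'M[F]_d) a q : cyclic_mx C ->
  char_poly C = ('X - a%:P) * q -> ~~ root q a -> one_cell a C.
Proof.
move=> cycC charC nq.
have mq : q \is monic by rewrite -(monicMl _ (monicXsubC a)) -charC char_poly_monic.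
have sq : size q = (size q).-1.+1 by rewrite prednK // size_poly_gt0 monic_neq0.
exists (size q).-1, (comp_mx (size q).-1 q); apply: cyclic_coprime_split => //.
- by rewrite -jordan_cell1; apply: cyclic_jordan_cell.
- exact: cyclic_comp.
- by rewrite char_poly_scalar1 char_poly_comp // coprimep_sym coprimep_XsubC.
- by rewrite char_poly_scalar1 char_poly_comp.
Qed.
End Jordan.

(** * Finding a pivot *)

Section CaseAnalysis.
Variable F : fieldType.
Implicit Types p q : {poly F}.

Definition kills p n (N : 'M[F]_n) : Prop := forall x, pact x N p = 0.

Lemma kills_similar p m n (A : 'M[F]_m) (B : 'M[F]_n) :
  similar_mx A B -> kills p A -> kills p B.
Proof.
move=> [P [Q [PQ QP PA]]] kA x.
have BP : B *m P = P *m A by [].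
by rewrite -[LHS]mulmx1 -PQ mulmxA (pact_morph _ _ BP) kA mul0mx.
Qed.

Lemma kills_block p m n (A : 'M[F]_m) (B : 'M[F]_n) :
  kills p (block_mx A 0 0 B) <-> kills p A /\ kills p B.
Proof.
split=> [kAB | [kA kB] x].
  by split=> x; [have := kAB (row_mx x 0) | have := kAB (row_mx 0 x)];
    rewrite pact_block -row_mx0 => /eq_row_mx[].
by rewrite -[x]hsubmxK pact_block kA kB row_mx0.
Qed.

Lemma kills_dvd p q n (N : 'M[F]_n) : p %| q -> kills p N -> kills q N.
Proof. by move=> pq kN x; apply: pact_dvd (kN x) pq. Qed.

Lemma kills_char_poly n (N : 'M[F]_n) : kills (char_poly N) N.
Proof. by move=> x; apply: pact_char_poly. Qed.

Lemma cyclic_kills_dvd p n (C : 'M[F]_n) :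
  cyclic_mx C -> kills p C -> char_poly C %| p.
Proof.
move=> [v uK] kC; apply: pact_cyclic_dvd uK _ _ _ (kC v).
- exact: char_poly_monic.
- exact: size_char_poly.
- exact: pact_char_poly.
Qed.

Lemma cyclic_scalar1 (a : F) : cyclic_mx (a%:M : 'M_1).
Proof. by rewrite -jordan_cell1; apply: cyclic_jordan_cell. Qed.

Lemma dvdp_irreducible_exp q p k : irreducible_poly q -> p %| q ^+ k ->
  exists j, p %= q ^+ j.
Proof.
move=> irr; elim: k p => [|k IHk] p; first by rewrite expr0 dvdp1 size_poly_eq1; exists 0%N.
rewrite exprS => pq; have [qp | nqp] := boolP (q %| p).
  move: pq; rewrite -(divpK qp) [q * _]mulrC dvdp_mul2r ?irredp_neq0 // => /IHk[j pj].
  by exists j.+1; rewrite exprSr eqp_mul2r ?irredp_neq0.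
apply: IHk; rewrite -(Gauss_dvdpr _ (_ : coprimep p q)) //.
rewrite /coprimep; apply/negPn/negP => sz1; case/negP: nqp.
have := irr _ sz1 (dvdp_gcdr p q) => /andP[_ qg].
exact: dvdp_trans qg (dvdp_gcdl p q).
Qed.

(** The characteristic polynomial is the product of those of the cyclic blocks,
    and each of these divides q^k. *)
Lemma char_poly_irreducible_exp q k n (N : 'M[F]_n) :
  irreducible_poly q -> q \is monic -> kills (q ^+ k) N ->
  exists e, char_poly N = q ^+ e.
Proof.
move=> irr mq; have [l le_l] := ubnP n.
elim: l n N le_l => // l IHl n N; rewrite ltnS => le_l kN.
have [n0 | n_gt0] := posnP n.
  exists 0%N; apply/eqP; rewrite -eqp_monic ?char_poly_monic ?monic1 // -size_poly_eq1.
  by rewrite size_char_poly n0.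
have [d [m [C [N0 [d0 simN cycC _]]]]] := cyclic_split N n_gt0.
have szn := similar_size simN; have lt_m : (m < l)%N by lia.
have /kills_block[kC kN0] := kills_similar simN kN.
have [e0 charN0] := IHl m N0 lt_m kN0.
have [e1 charC] := dvdp_irreducible_exp irr (cyclic_kills_dvd cycC kC).
exists (e1 + e0)%N; rewrite (similar_char_poly simN) char_poly_block charN0 exprD.
by congr (_ * _); apply/eqP; rewrite -eqp_monic ?char_poly_monic ?monic_exp.
Qed.

Lemma monic_linear p : p \is monic -> size p = 2 -> exists a, p = 'X - a%:P.
Proof.
move=> mp sp; exists (- p`_0); rewrite polyCN opprK {1}(monic_split mp sp) expr1.
by congr (_ + _); apply/polyP => -[|i]; rewrite coef_take_poly coefC.
Qed.

(** Replace the Krylov basis v C^j by v, v C, delta v C^2, delta^2 v C^3, ... *)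
Lemma cyclic_similar_sgn_comp d delta (C : 'M[F]_d) : delta * delta = 1 ->
  (1 < d)%N -> cyclic_mx C ->
  exists p, [/\ p \is monic, size p = d.+1
    & similar_mx C (sgn_mx d delta *m comp_mx d p)].
Proof.
move=> delta2 d1 cycC; set p0 := char_poly C.
pose g (j : nat) : F := delta ^+ j.-1.
have gg j : g j * g j = 1 by rewrite /g -exprMn delta2 expr1n.
pose r := \poly_(j < d) (delta * g d.-1 * g j * p0`_j).
have sr : (size r < size ('X^d : {poly F}))%N by rewrite size_polyXn ltnS size_poly.
exists ('X^d + r); split.
- by rewrite monicE lead_coefDl // lead_coefXn.
- by rewrite size_polyDl // size_polyXn.
apply: similar_trans (cyclic_similar_comp cycC) _.
pose G : 'M[F]_d := diag_mx (\row_j g j).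
apply: (@similar_unit _ _ _ _ G).
  rewrite unitmxE det_diag unitfE; apply/prodf_neq0 => j _; rewrite mxE.
  by apply: contra_eq_neq (gg j) => ->; rewrite mul0r eq_sym oner_neq0.
apply/matrixP => i j; rewrite mul_diag_mx mul_mx_diag mul_diag_mx !mxE.
have [eq_i | ne_i] := eqVneq i.+1 d.
  have i0 : (i == 0%N :> nat) = false by apply/eqP => i0; move: d1; rewrite -eq_i i0.
  rewrite coefD coefXn (ltn_eqF (ltn_ord j)) add0r coef_poly ltn_ord i0.
  have -> : d.-1 = i by apply: succn_inj; rewrite eq_i prednK // ltnW.
  rewrite -/p0; transitivity (- ((delta * delta) * (g j * g j) * (g i * p0`_j))).
    by rewrite delta2 gg !mul1r mulrN.
  ring.
have [<- | _] := eqVneq i.+1 (j : nat); last by rewrite !mulr0 mul0r.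
rewrite !mulr1 /g /=; case: (nat_of_ord i) => [|k] /=; first by rewrite mulr1.
by rewrite exprS mulrA delta2 mul1r.
Qed.

Lemma flexible_add_cyclic m d delta e (A : 'M[F]_m) (C : 'M[F]_d) :
  delta * delta = 1 -> \det A != 0 -> flexible delta e A ->
  cyclic_mx C -> (1 < d)%N -> \det C != 0 -> (d = 2 -> delta * \det C != e) ->
  flexible delta e (block_mx A 0 0 C).
Proof.
move=> delta2 dA flexA cycC d1 dC dCe.
have [p [mp sp simC]] := cyclic_similar_sgn_comp delta2 d1 cycC.
have detC := similar_det simC; rewrite det_sgn_comp // 1?ltnW // in detC.
apply: similar_flexible (similar_blockr _ (similar_sym simC)) _.
apply: flexible_block => //.
  by apply: contraNneq dC => p00; rewrite detC p00 !mulr0.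
move=> d2; move: (dCe d2); rewrite detC d2 expr1 sqrrN expr1n mul1r.
by rewrite mulrA delta2 mul1r.
Qed.

(** A block that [flexible_block] can attach: for d = 2 the constant coefficient
    p(0) is delta times the determinant. *)
Definition linkable (delta e : F) d (C : 'M[F]_d) : Prop :=
  [/\ cyclic_mx C, (1 < d)%N
    & d = 2 -> \det C != 0 -> delta * \det C != e].

Lemma flexible_block_sum m n delta e (A : 'M[F]_m) (N : 'M[F]_n) :
  delta * delta = 1 -> flexible delta e A -> \det A != 0 -> \det N != 0 ->
  block_sum (linkable delta e) N -> flexible delta e (block_mx A 0 0 N).
Proof.
move=> delta2 flexA dA dN sN; elim: sN m A flexA dA dN => {n N}
  [N | d k n C N M [cycC d1 dCe] _ IHN simM] m A flexA dA dM.
  exact: similar_flexible (similar_sym (similar_block0 _ _)) flexA.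
have := similar_det simM; rewrite det_ublock => detM.
have [dC dN] : \det C != 0 /\ \det N != 0.
  by apply/andP; move: dM; rewrite detM mulf_eq0 negb_or.
apply: similar_flexible (similar_sym (similar_blockr _ simM)) _.
apply: similar_flexible (similar_sym (similar_blockA _ _ _)) _.
apply: IHN => //; last by rewrite det_ublock mulf_neq0.
by apply: flexible_add_cyclic => // d2; apply: dCe.
Qed.

Lemma block_sum_sub (P Q : forall d, 'M[F]_d -> Prop) n (N : 'M[F]_n) :
  (forall d (C : 'M[F]_d), P d C -> Q d C) -> block_sum P N -> block_sum Q N.
Proof.
move=> PQ; elim=> {n N} [M | d k n C N M PC _ IHN simM]; first exact: block_sum_nil.
by apply: block_sum_cons IHN simM; apply: PQ.
Qed.

Lemma flexible_large_cyclic m n delta (A : 'M[F]_m) (N : 'M[F]_n) :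
  delta * delta = 1 -> cyclic_mx A -> (2 < m)%N ->
  \det (block_mx A 0 0 N) != 0 -> block_sum (@large_cyclic F) N ->
  flexible delta 0 (block_mx A 0 0 N).
Proof.
move=> delta2 cycA m2; rewrite det_ublock mulf_eq0 negb_or => /andP[dA dN].
have flexA : flexible delta 0 A.
  apply: similar_flexible (similar_sym (cyclic_similar_comp cycA)) _.
  by apply: flexible_comp; rewrite ?char_poly_monic ?size_char_poly.
have nz_delta : delta != 0.
  by apply: contraTneq (oner_neq0 F) => d0; rewrite -delta2 d0 mul0r eqxx.
move=> sN; apply: flexible_block_sum => //; apply: block_sum_sub sN => d C [cC d1].
by split=> // _ dC; rewrite mulf_neq0.
Qed.

Lemma flexible_quadratic_pair m n delta (A : 'M[F]_m) (B : 'M[F]_n) :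
  m = 2 -> n = 2 -> delta * delta = 1 -> cyclic_mx A -> cyclic_mx B ->
  \det A != 0 -> \det B != 0 -> \det A != \det B ->
  flexible delta (delta * \det A) (block_mx A 0 0 B).
Proof.
move=> m2 n2 delta2; subst m n => cA cB dA dB dAB.
have nz_delta : delta != 0.
  by apply: contraTneq (oner_neq0 F) => d0; rewrite -delta2 d0 mul0r eqxx.
have simA := cyclic_similar_comp cA.
have [p [mp sp simB]] := cyclic_similar_sgn_comp delta2 (isT : 1 < 2)%N cB.
have detA : \det A = (char_poly A)`_0 by rewrite char_poly_det expr2 mulrNN !mulr1 mul1r.
have detB : \det B = delta * p`_0.
  by rewrite (similar_det simB) det_sgn_comp // expr1 expr2 mulrNN !mulr1 mul1r.
apply: similar_flexible (similar_sym (similar_block simA simB)) _.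
rewrite detA; apply: flexible_two_quadratics => //.
- exact: char_poly_monic.
- exact: size_char_poly.
- by rewrite -detA.
- by apply: contraNneq dB => p0; rewrite detB p0 mulr0.
- rewrite -detA; apply: contraNneq dAB => e.
  by rewrite detB -e mulrA delta2 mul1r.
Qed.

(** The characteristic polynomial is a divisor of degree 2 of (X - a)^2 (X - b);
    if it were (X - a)(X - b), there would be a cell of size 1 for a. *)
Lemma det_double_root (C : 'M[F]_2) (a b : F) : cyclic_mx C -> a != b ->
  kills (('X - a%:P) ^+ 2 * ('X - b%:P)) C -> ~ one_cell a C ->
  \det C = a * a.
Proof.
move=> cC ab kC ncell; have dvdC := cyclic_kills_dvd cC kC.
have mC := char_poly_monic C; have sC := size_char_poly C.
suff charC : char_poly C = ('X - a%:P) ^+ 2.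
  have := char_poly_det C; rewrite charC -horner_coef0 horner_exp hornerXsubC.
  by rewrite sub0r !sqrrN expr1n mul1r => <-; rewrite expr2.
have [rb | nrb] := boolP (root (char_poly C) b).
  have [q charC] := factor_theorem _ _ rb.
  have mq : q \is monic by rewrite -(monicMr _ (monicXsubC b)) -charC.
  have sq : size q = 2.
    move: sC; rewrite charC size_mul ?monic_neq0 ?monicXsubC // size_XsubC.
    by rewrite addnS addn1 => -[].
  have [c qE] := monic_linear mq sq.
  have : q %| ('X - a%:P) ^+ 2.
    by move: dvdC; rewrite charC dvdp_mul2r ?polyXsubC_eq0.
  rewrite qE dvdp_XsubCl root_exp_XsubC => /eqP ca.
  case: ncell; apply: (@one_cell_simple_root _ _ _ _ ('X - b%:P)) => //.
    by rewrite charC qE ca.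
  by rewrite root_XsubC.
apply/eqP; rewrite -eqp_monic ?monic_exp ?monicXsubC //.
rewrite -dvdp_size_eqp ?sC ?size_exp_XsubC //.
by rewrite -(Gauss_dvdpl _ (_ : coprimep _ ('X - b%:P))) ?coprimep_XsubC.
Qed.

Lemma block_sum_double_root n (N : 'M[F]_n) a b delta : delta * delta = 1 ->
  a != 0 -> a != b -> kills (('X - a%:P) ^+ 2 * ('X - b%:P)) N -> ~ one_cell a N ->
  block_sum (@large_cyclic F) N ->
  block_sum (linkable delta (delta * (a * b))) N.
Proof.
move=> delta2 a0 ab kN ncell sN; elim: sN kN ncell => {n N}
  [N | d k n C N M [cycC d1] _ IHN simM] kM ncell; first exact: block_sum_nil.
have /kills_block[kC kN] := kills_similar simM kM.
apply: (block_sum_cons _ _ simM); last first.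
  apply: IHN kN _ => cN; apply: ncell.
  exact: similar_one_cell simM (one_cell_right _ cN).
have nC : ~ one_cell a C.
  by move=> cC; apply: ncell; apply: similar_one_cell simM (one_cell_left _ cC).
split=> // d2 _; subst d; rewrite (det_double_root cycC ab kC nC).
have nz_delta : delta != 0.
  by apply: contraTneq (oner_neq0 F) => d0; rewrite -delta2 d0 mul0r eqxx.
by rewrite (inj_eq (mulfI nz_delta)) (inj_eq (mulfI a0)).
Qed.

(** The sum of the blocks (X - a)^k q and X - a is also the sum of the blocks
    A = (X - a)^k and B = (X - a) q.  If k > 2, then A is a pivot; if q has
    degree more than 1, then B is a pivot.  Otherwise q = X - b, and the pair
    B, A starts the construction: their determinants are a b and a^2, and every
    further block of size 2 has determinant a^2. *)
Lemma flexible_split_cell m n l delta (a : F) q (C : 'M[F]_m) (N : 'M[F]_n)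
    (N1 : 'M[F]_l) k : delta * delta = 1 ->
  \det (block_mx C 0 0 N) != 0 ->
  cyclic_mx C -> char_poly C = ('X - a%:P) ^+ k * q -> ~~ root q a ->
  (1 < k)%N -> (1 < size q)%N -> kills (char_poly C) N ->
  similar_mx N (block_mx (a%:M : 'M_1) 0 0 N1) ->
  block_sum (@large_cyclic F) N1 -> ~ one_cell a N1 ->
  exists e, flexible delta e (block_mx C 0 0 N).
Proof.
move=> delta2 dM cycC charC nq k1 q1 killN simN sN1 ncell.
have mq : q \is monic.
  by rewrite -(monicMl _ (monic_exp k (monicXsubC a))) -charC char_poly_monic.
set s := (size q).-1; have sq : size q = s.+1 by rewrite prednK // ltnW.
pose q' := ('X - a%:P) * q.
have mq' : q' \is monic by rewrite monicMl ?monicXsubC.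
have sq' : size q' = (size q).+1.
  by rewrite size_mul ?monic_neq0 ?monicXsubC // size_XsubC.
pose A := comp_mx k (('X - a%:P) ^+ k); pose B := comp_mx (size q) q'.
have mA : ('X - a%:P) ^+ k \is monic by rewrite monic_exp ?monicXsubC.
have cA : cyclic_mx A := cyclic_comp _ _; have cB : cyclic_mx B := cyclic_comp _ _.
have charA : char_poly A = ('X - a%:P) ^+ k by rewrite char_poly_comp ?size_exp_XsubC.
have charB : char_poly B = q' by rewrite char_poly_comp.
have co : coprimep ('X - a%:P) q by rewrite coprimep_sym coprimep_XsubC.
have simC : similar_mx C (block_mx A 0 0 (comp_mx s q)).
  apply: cyclic_coprime_split => //; first exact: cyclic_comp.
    by rewrite charA char_poly_comp // coprimep_expl.
  by rewrite charA char_poly_comp.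
have simB : similar_mx B (block_mx (comp_mx s q) 0 0 (a%:M : 'M_1)).
  apply: cyclic_coprime_split => //; first exact: cyclic_comp.
  - exact: cyclic_scalar1.
  - by rewrite char_poly_scalar1 char_poly_comp // coprimep_sym.
  - by rewrite char_poly_scalar1 char_poly_comp // charB mulrC.
have simM : similar_mx (block_mx C 0 0 N) (block_mx A 0 0 (block_mx B 0 0 N1)).
  apply: similar_trans (similar_block simC simN) _.
  apply: similar_trans (similar_sym (similar_blockA _ _ _)) _; apply: similar_blockr.
  apply: similar_trans (similar_blockA _ _ _) _; apply: similar_blockl.
  exact: similar_sym.
rewrite (similar_det simM) in dM.
have [k2 | k2] := ltnP 2 k.
  exists 0; apply: similar_flexible (similar_sym simM) _.
  by apply: flexible_large_cyclic => //; apply: block_sum_cons sN1 (similar_refl _).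
have simM' := similar_trans simM (similar_blockCA _ _ _).
have dM' := dM; rewrite (similar_det (similar_blockCA _ _ _)) in dM'.
have [q2 | q2] := ltnP 2 (size q).
  exists 0; apply: similar_flexible (similar_sym simM') _.
  by apply: flexible_large_cyclic => //; apply: block_sum_cons sN1 (similar_refl _).
have {k1 k2} kE : k = 2 by apply/eqP; rewrite eqn_leq k2.
have {q1 q2} qE : size q = 2 by apply/eqP; rewrite eqn_leq q2.
(* Neither A nor B has size 3 or more: all polynomials are explicit now. *)
have [b bE] := monic_linear mq qE.
have ab : a != b by move: nq; rewrite bE root_XsubC.
have killN1 : kills (('X - a%:P) ^+ 2 * ('X - b%:P)) N1.
  have /kills_block[_] := kills_similar simN killN.
  by rewrite charC kE bE.
move: dM'; rewrite det_ublock mulf_eq0 negb_or => /andP[dB].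
rewrite det_ublock mulf_eq0 negb_or => /andP[dA dN1].
exists (delta * \det B).
apply: similar_flexible (similar_sym simM') _.
apply: similar_flexible (similar_sym (similar_blockA _ _ _)) _.
have detA : \det A = a * a.
  rewrite det_comp ?size_exp_XsubC // kE -horner_coef0 horner_exp hornerXsubC.
  by rewrite sub0r !sqrrN expr1n mul1r expr2.
have detB : \det B = a * b.
  rewrite det_comp // qE /q' bE -horner_coef0 hornerM !hornerXsubC.
  by rewrite !sub0r mulrNN sqrrN expr1n mul1r.
have a0 : a != 0 by apply: contraNneq dA => a0; rewrite detA a0 mul0r.
apply: flexible_block_sum => //.
- apply: flexible_quadratic_pair => //.
  by rewrite detA detB (inj_eq (mulfI a0)) eq_sym.
- by rewrite det_ublock mulf_neq0.
- by rewrite detB; apply: block_sum_double_root.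
Qed.
Lemma irreducible_exp_not_kills n (M : 'M[F]_n) :
  ~ (exists (p : {poly F}) (e : nat), irreducible_poly p /\ char_poly M = p ^+ e) ->
  forall q k, irreducible_poly q -> q \is monic -> ~ kills (q ^+ k) M.
Proof.
move=> notpow q k irr mq kM; apply: notpow.
by have [e charM] := char_poly_irreducible_exp irr mq kM; exists q, e.
Qed.

(** Case distinction on the degree d of the polynomial p of the first block, which
    kills M.  If d = 1 or p is irreducible, then p gives a power that is
    excluded.  If p = (X - a)(X - b) with a <> b, then all other blocks
    share a root with p, which yields two cells of size 1.  If d > 2, the first block is
    a pivot, unless there is a block of size 1. *)
Lemma completable_of_cells n delta (M : 'M[F]_n) :
  delta * delta = 1 -> \det M != 0 -> (0 < n)%N ->
  (forall q k, irreducible_poly q -> q \is monic -> ~ kills (q ^+ k) M) ->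
  (forall a, ~ two_cells a M) -> completable delta M.
Proof.
move=> delta2 dM n_gt0 notpow nocells.
have [d [m [C [N [d0 simM cycC killN]]]]] := cyclic_split M n_gt0.
have killM p : char_poly C %| p -> kills p M.
  move=> Cp; apply: kills_similar (similar_sym simM) _; apply/kills_block.
  by split; apply: (kills_dvd Cp) => //; apply: kills_char_poly.
have compl_of e : flexible delta e (block_mx C 0 0 N) -> completable delta M.
  by move/flexible_completable; apply: similar_completable (similar_sym simM).
have mC := char_poly_monic C; have sC := size_char_poly C.
have not_linear_power a k : char_poly C != ('X - a%:P) ^+ k.
  apply/eqP => charC; apply: (notpow ('X - a%:P) k).
  - exact: irredp_XsubC.
  - exact: monicXsubC.
  - by apply: killM; rewrite charC.
(* M is cyclic. *)
have [m0 | m_gt0] := posnP m.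
  subst m; have simC := similar_trans simM (similar_block0 C N).
  have simC' := similar_trans simC (cyclic_similar_comp cycC).
  apply: similar_completable (similar_sym simC') _.
  exact: completable_comp.
have [d1 | d1] := ltnP d 2.
  have {d0 d1} dE : d = 1%N by apply/eqP; rewrite eqn_leq d0 -ltnS d1.
  have [a charC] : exists a, char_poly C = 'X - a%:P.
    by apply: monic_linear => //; rewrite sC dE.
  by have := not_linear_power a 1%N; rewrite charC expr1 eqxx.
have [d2 | d2] := ltnP 2 d; last first.
  have {d1 d2} dE : d = 2 by apply/eqP; rewrite eqn_leq d2.
  have [a ra] : exists a, root (char_poly C) a.
    apply: NNPP => noroot; apply: (notpow (char_poly C) 1%N) => //.
      apply: cubic_irreducible; first by rewrite sC dE.
      by move=> x; apply/negP => rx; apply: noroot; exists x.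
    exact: killM.
  have [q charC] := factor_theorem _ _ ra.
  have mq : q \is monic by rewrite -(monicMr _ (monicXsubC a)) -charC.
  have [b qE] : exists b, q = 'X - b%:P.
    apply: monic_linear => //; move: sC.
    rewrite charC size_mul ?monic_neq0 ?monicXsubC // size_XsubC dE.
    by rewrite addnS addn1 => -[].
  have ab : a != b.
    by apply: contraNneq (not_linear_power a 2) => ab; rewrite charC qE -ab -expr2.
  have [d' [m' [C' [N' [d'0 simN cycC' _]]]]] := cyclic_split N m_gt0.
  have /kills_block[kC' _] := kills_similar simN killN.
  have dvdC' := cyclic_kills_dvd cycC' kC'; rewrite charC qE in dvdC'.
  (* x stands for a or b: it is a simple root of p, hence of each divisor of p. *)
  have common x y : x != y -> char_poly C' %| ('X - x%:P) * ('X - y%:P) ->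
      char_poly C = ('X - x%:P) * ('X - y%:P) -> root (char_poly C') x -> False.
    move=> xy dvd' charC2 rx; apply: (nocells x); apply: similar_two_cells simM _.
    apply: two_cells_block.
      by apply: one_cell_simple_root charC2 _; rewrite // root_XsubC.
    apply: similar_one_cell simN (one_cell_left _ _).
    have [q' charC'] := factor_theorem _ _ rx; rewrite mulrC in charC'.
    apply: (one_cell_simple_root cycC' charC').
    move: dvd'; rewrite charC' dvdp_mul2l ?polyXsubC_eq0 // => dvd_q'.
    apply/negP => rq'; have := dvdp_trans _ dvd_q'; move/(_ ('X - x%:P)).
    by rewrite !dvdp_XsubCl rq' root_XsubC (negPf xy) => /(_ isT).
  have [ra' | nra'] := boolP (root (char_poly C') a).
    by case: (common a b) => //; rewrite ?charC ?qE mulrC.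
  have [rb' | nrb'] := boolP (root (char_poly C') b).
    by case: (common b a) => //; rewrite ?charC ?qE 1?eq_sym.
  have co : coprimep (char_poly C') (('X - b%:P) * ('X - a%:P)).
    by rewrite coprimepMr !coprimep_XsubC nra' nrb'.
  have dvd_ba : char_poly C' %| ('X - b%:P) * ('X - a%:P).
    by rewrite mulrC; move: dvdC'; rewrite mulrC.
  have := (coprimepP _ _ co) _ (dvdpp _) dvd_ba.
  by rewrite -size_poly_eq1 size_char_poly eqSS => /eqP d'E; rewrite d'E in d'0.
have [sN | [a [l [N1 [simN sN1]]]] | [a two]] := similar_large_tail N.
- apply: (compl_of 0); apply: flexible_large_cyclic => //.
  by rewrite -(similar_det simM).
- have [k [q [mq nq charC]]] := root_power_factor a mC.
  have cellN : one_cell a N by exists l, N1.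
  have ra : root (char_poly C) a.
    have /kills_block[ka _] := kills_similar simN killN.
    rewrite -dvdp_XsubCl -char_poly_scalar1; apply: cyclic_kills_dvd ka.
    exact: cyclic_scalar1.
  have k0 : (0 < k)%N.
    by case: k charC => // charC; move: ra; rewrite charC mul1r (negPf nq).
  have k1 : (1 < k)%N.
    rewrite ltn_neqAle k0 andbT; apply/eqP => k1; apply: (nocells a).
    apply: similar_two_cells simM (two_cells_block _ cellN).
    by apply: one_cell_simple_root nq => //; rewrite charC -k1.
  have q1 : (1 < size q)%N.
    have sq0 : (0 < size q)%N by rewrite size_poly_gt0 monic_neq0.
    rewrite ltn_neqAle sq0 andbT; apply/eqP => q1.
    have := not_linear_power a k; rewrite charC.
    have -> : q = 1 by apply/eqP; rewrite -eqp_monic ?monic1 // -size_poly_eq1 -q1.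
    by rewrite mulr1 eqxx.
  have ncell : ~ one_cell a N1.
    move=> cell1; apply: (nocells a); apply: similar_two_cells simM _.
    apply/two_cells_right/(similar_two_cells simN)/two_cells_block => //.
    exists 0%N, (0 : 'M_0); apply: similar_sym; exact: similar_block0.
  have dM' : \det (block_mx C 0 0 N) != 0 by rewrite -(similar_det simM).
  have [e] := flexible_split_cell delta2 dM' cycC charC nq k1 q1 killN simN sN1 ncell.
  exact: compl_of.
- by case: (nocells a); apply: similar_two_cells simM (two_cells_right C two).
Qed.
End CaseAnalysis.

(** * The theorem *)

Theorem theorem1p6 (F : fieldType) (n : nat) (M : 'M[F]_n)
    (M_unit : M \in unitmx)
    (M_det : \det M = 1 \/ \det M = -1)
    (M_cells : forall a : F, eigenvalue M a ->
       at_most_one_jordan_cell_of_size1 M a)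
    (M_char : ~ exists (p : {poly F}) (e : nat),
       irreducible_poly p /\ char_poly M = p ^+ e) :
  (forall k : nat, (k <= 2)%N -> prod_unipotent2_involution k M) /\
  (\det M = 1 -> exists A B C : 'M[F]_n,
     [/\ unipotent2 A, unipotent2 B, unipotent2 C & M = A *m B *m C]).
Proof.
have det2 : \det M * \det M = 1 by case: M_det => ->; rewrite ?mulrNN mulr1.
have det0 : \det M != 0 by rewrite unitmxE unitfE in M_unit.
have n_gt0 : (0 < n)%N.
  rewrite lt0n; apply/eqP => n0; apply: M_char; exists ('X - 0%:P), 0%N.
  split; first exact: irredp_XsubC.
  apply/eqP; rewrite expr0 -eqp_monic ?char_poly_monic ?monic1 // -size_poly_eq1.
  by rewrite size_char_poly n0.
have compl (delta : F) : delta * delta = 1 -> completable delta M.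
  move=> delta2; apply: completable_of_cells => //.
    exact: irreducible_exp_not_kills.
  by move=> a; apply: no_two_cells; apply: M_cells.
have sqr1 : 1 * 1 = 1 :> F by rewrite mulr1.
have sqrN1 : -1 * -1 = 1 :> F by rewrite mulrNN mulr1.
pose sgn (b : bool) : F := if b then 1 else -1.
have typed (b : bool) (A : 'M[F]_n) : quadratic_mx (sgn b) A ->
    if b then unipotent2 A else involution A.
  by case: b; [exact: quadratic_unipotent2 | exact: quadratic_involution].
split=> [k k2 | det1].
  have [|||||A [B [C [qA qB qC MABC]]]] :=
      @three_quadratics F n (sgn (0 < k)%N) (sgn (1 < k)%N) (-1) M n_gt0.
  - by apply: compl; rewrite /sgn; case: ifP.
  - exact: M_unit.
  - by rewrite /sgn; case: ifP.
  - by rewrite /sgn; case: ifP => _; [left | right].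
  - by left.
  exists (fun i : 'I_3 => i < k)%N.
  exists (fun i : 'I_3 => if i == 0 then A else if i == 1 then B else C).
  split=> [|i|//].
    rewrite -sum1_card big_mkcond !big_ord_recl big_ord0 !inE /=.
    by case: k k2 {qA qB} => [|[|[|k]]].
  case: i => [[|[|[|i]]] lt_i] //=.
  - exact: (typed (0 < k)%N).
  - exact: (typed (1 < k)%N).
  - by rewrite ltnNge k2; apply: (typed false).
have [|||||A [B [C [qA qB qC MABC]]]] := @three_quadratics F n 1 1 1 M n_gt0.
- exact: compl.
- exact: M_unit.
- exact: sqr1.
- by left.
- by right.
by exists A, B, C.
Qed.
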